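(* Let $K$ be a non-Archimedean local field with residue field of cardinality $q$, and let $\varphi:K\to\mathbb C$ satisfy $\varphi\in L^\infty_{\mathrm{loc}}(K)$ and $\varphi(t)=O(|t|_K^{-\beta})$ as $|t|_K\to\infty$ for some $\beta>1$. Let $u=D^{-1}\varphi$, let $\varepsilon=q^{-\nu}$ with $\nu\in\mathbb N$, and let $\sigma\in K$ satisfy $|\sigma|_K=\varepsilon$. Then the truncated operator $D^1_\varepsilon u$ admits the representation $$ \left(D^1_\varepsilon u\right)(x)=c_1d_1\int_K R(\tau)\,\varphi(x-\sigma\tau)\,d\tau, $$ where $$ R(\tau)=\begin{cases}\dfrac{\log q}{q-1}-\log|\tau|_K, & \text{if } 0<|\tau|_K<1,\\ 0, & \text{if } |\tau|_K\ge 1.\end{cases} $$ Moreover, the kernel $R_1(\tau)=c_1d_1R(\tau)$ satisfies $$ R_1(\tau)>0\ \text{ for } 0<|\tau|_K<1,\qquad \int_K R_1(\tau)\,d\tau=1. $$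
   Context: $K$ is a non-Archimedean local field (a non-discrete totally disconnected locally compact topological field) with normalized absolute value $|\cdot|_K$: if $O=\{x\in K:|x|_K\le 1\}$, $P=\{x\in K:|x|_K<1\}=\pi O$, and $q$ is the cardinality of the finite residue field $O/P$, then $|\pi|_K=q^{-1}$. $dx$ is the Haar measure on the additive group of $K$ normalized so that $O$ has measure $1$. $\log$ is the natural logarithm. $L^\infty_{\mathrm{loc}}(K)$ denotes the measurable functions essentially bounded on every compact subset of $K$. The logarithmic Riesz potential is $$(D^{-1}\varphi)(x)=d_1\int_K\log|x-y|_K\,\varphi(y)\,dy,\qquad d_1=\frac{1-q}{q\log q},$$ and the truncated fractional differentiation operator of order $1$ is $$(D^1_\varepsilon u)(x)=c_1\int_{|y-x|_K\ge\varepsilon}\frac{u(y)-u(x)}{|y-x|_K^{2}}\,dy,\qquad c_1=\frac{1-q}{1-q^{-2}}=-\frac{q^2}{q+1}.$$ *)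

(* Defs.v *)
From HB Require Import structures.
From mathcomp Require Import all_boot all_order all_algebra.
From mathcomp Require Import complex.
From mathcomp Require Import all_classical all_reals all_analysis.

Set Implicit Arguments.
Unset Strict Implicit.
Unset Printing Implicit Defensive.

Import Order.TTheory GRing.Theory Num.Theory.
Import numFieldNormedType.Exports.

Local Open Scope classical_set_scope.
Local Open Scope ring_scope.
Local Open Scope complex_scope.

HB.mixin Record isTopologicalField K
    & TopologicalZmodule K & GRing.Field K := {
  field_mul_continuous : continuous (fun z : K * K => z.1 * z.2);
  field_inv_continuous :
    forall x : K, x != 0 -> {for x, continuous (@GRing.inv K)}
}.

#[short(type="topologicalFieldType")]
HB.structure Definition TopologicalField :=
  {K of TopologicalZmodule K & GRing.Field K
      & isTopologicalField K}.

HB.mixin Record isNonArchLocalField K & TopologicalField K := {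
  nalf_hausdorff : hausdorff_space K;
  nalf_locally_compact : locally_compact [set: K];
  nalf_totally_disconnected : totally_disconnected [set: K];
  nalf_nondiscrete : @nbhs K K <> principal_filter
}.

#[short(type="nonArchLocalFieldType")]
HB.structure Definition NonArchLocalField :=
  {K of TopologicalField K & isNonArchLocalField K}.

(* Measurable types must be pointed; K itself carries no canonical point. *)
Definition pointed_carrier (K : nonArchLocalFieldType) : Type := K.

HB.instance Definition _ (K : nonArchLocalFieldType) :=
  Choice.copy (pointed_carrier K) K.
HB.instance Definition _ (K : nonArchLocalFieldType) :=
  isPointed.Build (pointed_carrier K) (0 : K).

Definition borel (K : nonArchLocalFieldType) :=
  @g_sigma_algebraType (pointed_carrier K) (@open K).

Section absolute_value.
Context {R : realType} {K : nonArchLocalFieldType}.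
Variable abs : K -> R.

Definition int_ring : set K := [set x | abs x <= 1].

Definition max_ideal : set K := [set x | abs x < 1].

(* O/P, as the set of the cosets x + P, x in O *)
Definition residue_field : set (set K) :=
  [set [set x + p | p in max_ideal] | x in int_ring].

Record normalized_abs (q : nat) : Prop := {
  nabs_ge0 : forall x, 0 <= abs x;
  nabs_eq0 : forall x, abs x = 0 <-> x = 0;
  nabsM : forall x y, abs (x * y) = abs x * abs y;
  nabs_ultra : forall x y, abs (x + y) <= Num.max (abs x) (abs y);
  nabs_nbhs : forall (x : K) (A : set K),
    nbhs x A <-> exists2 r : R, 0 < r & [set y | abs (y - x) < r] `<=` A;
  nabs_residue : (residue_field #= `I_q)%card;
  nabs_uniformizer : exists2 pi : K,
    max_ideal = [set pi * x | x in int_ring] & abs pi = q%:R^-1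
}.

(* Regularity is not required: it is automatic, since the topology of K is
   metrizable and sigma-compact. *)
Record normalized_haar (mu : {measure set (borel K) -> \bar R}) : Prop := {
  haar_translation : forall (x : K) (A : set K),
    measurable (A : set (borel K)) -> mu [set x + a | a in A] = mu A;
  haar_compact : forall A : set K, compact A -> (mu A < +oo)%E;
  haar_int_ring : mu int_ring = 1%E
}.

End absolute_value.

Section complex_integral.
Context {d : measure_display} {T : measurableType d} {R : realType}.
Variable mu : {measure set T -> \bar R}.
Implicit Types (D : set T) (f : T -> R[i]).

Definition cmeasurable_fun D f : Prop :=
  measurable_fun D (fun t => complex.Re (f t)) /\
  measurable_fun D (fun t => complex.Im (f t)).

Definition cintegrable D f : Prop :=
  mu.-integrable D (fun t => (complex.Re (f t))%:E) /\
  mu.-integrable D (fun t => (complex.Im (f t))%:E).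

Definition cintegral D f : R[i] :=
  Rintegral mu D (fun t => complex.Re (f t)) +i*
  Rintegral mu D (fun t => complex.Im (f t)).

End complex_integral.

Section operators.
Context {R : realType} {K : nonArchLocalFieldType}.
Variables (abs : K -> R) (q : nat) (mu : {measure set (borel K) -> \bar R}).
Implicit Types (f u phi : K -> R[i]) (x y t tau : K) (eps : R).

(* Borel measurability: a Haar-measurable function agrees almost everywhere
   with a Borel one, which has the same integrals. *)
Definition Linfty_loc f : Prop :=
  cmeasurable_fun (setT : set (borel K)) f /\
  forall A : set K, compact A ->
    exists M : R, {ae mu, forall t : borel K, A t -> Normc.normc (f t) <= M}.

Definition bigO_at_infty (beta : R) f : Prop :=
  exists C M : R, forall t, M < abs t ->
    Normc.normc (f t) <= C * abs t `^ (- beta).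

Definition d1 : R := (1 - q%:R) / (q%:R * ln q%:R).

Definition c1 : R := (1 - q%:R) / (1 - q%:R ^- 2).

(* [ln 0 = 0] in the library, so the integrand is 0 on the null set y = x. *)
Definition riesz_integrand phi x (y : borel K) : R[i] :=
  (ln (abs (x - y)))%:C * phi y.

Definition log_riesz phi x : R[i] :=
  d1%:C * cintegral mu setT (riesz_integrand phi x).

Definition trunc_domain eps x : set (borel K) :=
  [set y : K | eps <= abs (y - x)].

Definition trunc_integrand u x (y : borel K) : R[i] :=
  (u y - u x) / (abs ((y : K) - x) ^+ 2)%:C.

Definition trunc_diff eps u x : R[i] :=
  c1%:C * cintegral mu (trunc_domain eps x) (trunc_integrand u x).

(* The value 0 at tau = 0 is a convention: {0} is a null set. *)
Definition kernelR tau : R :=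
  if 0 < abs tau < 1 then ln q%:R / (q%:R - 1) - ln (abs tau) else 0.

Definition kernelR1 tau : R := c1 * d1 * kernelR tau.

Definition kernel_integrand phi (sigma x : K) (tau : borel K) : R[i] :=
  (kernelR tau)%:C * phi (x - sigma * tau).

End operators.

(* Main.v *)
Require Import Defs.
From HB Require Import structures.
From mathcomp Require Import all_boot all_order all_algebra.
From mathcomp Require Import complex ring lra.
From mathcomp Require Import all_classical all_reals all_analysis.
From mathcomp Require Import measurable_realfun.

(** By translation invariance it suffices to look at [x = 0]. There the truncated
    operator applied to [u] is, up to the constants [c1] and [d1], the double
    integral over [eps <= |t|] and over [w] of

      [|t|^-2 (ln |t - w| - ln |w|) phi(w)],

    and everything follows from integrating in [t] first.

    The ultrametric inequality makes the kernel explicit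
    ([kernel_decomposition]). It vanishes for [|t| < |w|]; for [|t| > |w|] it is
    [|t|^-2 (ln |t| - ln |w|)], the outer kernel; and on the sphere [|t| = |w|]
    it is minus the inner kernel [|w|^-2 (ln |w| - ln |t - w|)]. Both kernels
    are nonnegative, and radial in [t] or in [s = t - w]. The values of a radial
    function on the spheres [|t| = |c| q^n], of measure [|c| q^n (1 - 1/q)],
    turn its integral into a series, here an arithmetico-geometric one since
    [ln] is affine in [n] ([ge0_integral_spheres]). With [L = ln q / (q - 1)],
    the inner kernel integrates to [L / |w|] if [eps <= |w|] and to 0 otherwise
    ([integral_inner_kernel]), the outer kernel to [L / |w|] if [eps <= |w|] and
    to [(ln eps - ln |w| + L) / eps] otherwise ([integral_outer]). The
    difference is 0 for [eps <= |w|] and [R(w / sigma) / eps] for [|w| < eps]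
    ([integral_kernel_difference]). The substitution [w = - sigma tau], whose
    modulus is [eps], then produces the announced representation
    ([Rintegral_trunc]).

    Fubini's theorem applies because the sum of the two integrals grows at most
    logarithmically as [|w|] tends to 0 or to infinity ([integral_kernel_sum]),
    and a logarithmic factor is integrable against [phi], which is locally
    bounded and decays faster than [1 / |w|] ([decays_integrable]).

    The substitutions rest on the scaling law [mu (x + c A) = |c| mu A]. For
    balls it comes from cutting a ball into [q] translates of the next smaller
    one, so that the ball of radius [|c|] has measure [|c|]. Balls form a
    generating system of the Borel sets that is closed under intersection, up
    to the empty set, because [K] is separable; so the law extends to all Borel
    sets ([mu_preimage_affine]).

    All kernels being real, the real and imaginary parts of [phi] are treated
    separately. The mass of [R_1] is one more radial series
    ([integral_kernelR1]). *)

Set Implicit Arguments.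
Unset Strict Implicit.
Unset Printing Implicit Defensive.

Import Order.TTheory GRing.Theory Num.Theory.
Import numFieldNormedType.Exports.

Local Open Scope classical_set_scope.
Local Open Scope ring_scope.
Local Open Scope complex_scope.

(** * Arithmetico-geometric series *)

Section series.
Context {R : realType}.
Implicit Types a b x : R.

Lemma bernoulli_le (h : R) n : 0 <= h -> 1 + n%:R * h <= (1 + h) ^+ n.
Proof.
move=> h0; elim: n => [|n ih]; first by rewrite mul0r addr0 expr0.
have n0 : 0 <= n%:R :> R by [].
rewrite exprS; apply: (@le_trans _ _ ((1 + h) * (1 + n%:R * h))).
  rewrite -natr1; nra.
by apply: ler_wpM2l => //; lra.
Qed.

(** Bernoulli's inequality bounds [n] by a multiple of [(1 + h) ^+ n]; the half
    in the choice of [h] keeps [x * (1 + h)] below 1. *)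
Lemma cvg_natr_expr x : 0 < x -> x < 1 -> n%:R * x ^+ n @[n --> \oo] --> (0 : R).
Proof.
move=> x0 x1; pose h := (x^-1 - 1) / 2.
have h0 : 0 < h.
  by rewrite divr_gt0// subr_gt0 invf_gt1.
pose y := x * (1 + h).
have y01 : 0 < y < 1.
  have e : y = (x + 1) / 2 by rewrite /y /h; field; rewrite gt_eqF.
  by rewrite e; apply/andP; split; lra.
case/andP: y01 => y0 y1.
apply: (@squeeze_cvgr _ _ _ _ (fun=> 0) (fun n => h^-1 * y ^+ n)).
- near=> n; apply/andP; split; first by rewrite mulr_ge0// exprn_ge0// ltW.
  rewrite /y exprMn mulrCA [n%:R * _]mulrC ler_pM2l ?exprn_gt0//.
  by rewrite ler_pdivlMl//; have := bernoulli_le n (ltW h0); lra.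
- exact: cvg_cst.
- rewrite -[X in _ --> X](mulr0 h^-1); apply: cvgMr; apply: cvg_expr.
  by rewrite ger0_norm// ltW.
Unshelve. all: by end_near. Qed.

(** What is subtracted is the tail of the series: [x ^+ n] times the same closed
    form, with [a] replaced by [a + b * n%:R]. *)
Lemma arithmetico_geometric_partial a b x n : x != 1 ->
  \sum_(0 <= i < n) (a + b * i%:R) * x ^+ i =
  (a / (1 - x) + b * x / (1 - x) ^+ 2)
  - (x ^+ n * (a / (1 - x) + b * x / (1 - x) ^+ 2) +
     (b / (1 - x)) * (n%:R * x ^+ n)).
Proof.
move=> x1; have d : 1 - x != 0 by rewrite subr_eq0 eq_sym.
elim: n => [|n ih].
  by rewrite big_geq// expr0 mul0r mulr0 addr0 mul1r subrr.
by rewrite big_nat_recr//= ih [x ^+ n.+1]exprS -[n.+1%:R]natr1; field.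
Qed.

(** All radial integrals below reduce to such series, because a logarithm is
    affine along the powers of a uniformizer. *)
Lemma nneseries_arithmetico_geometric a b x : 0 < x -> x < 1 ->
  (\sum_(n <oo) ((a + b * n%:R) * x ^+ n)%:E =
   (a / (1 - x) + b * x / (1 - x) ^+ 2)%:E)%E.
Proof.
move=> x0 x1; apply/cvg_lim => //.
under eq_fun do rewrite sumEFin arithmetico_geometric_partial ?lt_eqF//.
apply: cvg_EFin; first by near=> n.
rewrite /=; set S := (X in _ --> X).
rewrite -[X in _ --> X]subr0; apply: cvgB; first exact: cvg_cst.
rewrite -[X in _ --> X]addr0; apply: cvgD.
  rewrite -[X in _ --> X](mul0r S); apply: cvgMl; apply: cvg_expr.
  by rewrite ger0_norm// ltW.
rewrite -[X in _ --> X](mulr0 (b / (1 - x))); apply: cvgMr.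
exact: cvg_natr_expr.
Unshelve. all: by end_near. Qed.

End series.

(** * The value group and the residue field *)

Section absolute_value_theory.
Context {R : realType} {K : nonArchLocalFieldType} (abs : K -> R) (q : nat).
Hypothesis habs : normalized_abs abs q.
Implicit Types (x y c t : K) (n : nat).

Lemma abs_ge0 x : 0 <= abs x. Proof. exact: nabs_ge0 habs x. Qed.

Lemma abs0 : abs 0 = 0. Proof. by apply/(nabs_eq0 habs). Qed.

Lemma abs_gt0 x : (0 < abs x) = (x != 0).
Proof.
rewrite lt_def abs_ge0 andbT; congr (~~ _).
by apply/eqP/eqP => /(nabs_eq0 habs).
Qed.

Lemma absM x y : abs (x * y) = abs x * abs y. Proof. exact: nabsM habs x y. Qed.

Lemma abs1 : abs 1 = 1.
Proof.
have h : abs 1 != 0 by rewrite gt_eqF// abs_gt0 oner_eq0.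
by apply: (mulIf h); rewrite mul1r -absM mul1r.
Qed.

Lemma absN x : abs (- x) = abs x.
Proof.
have : abs (-1) ^+ 2 = 1 by rewrite expr2 -absM mulrN1 opprK abs1.
move/eqP; rewrite sqrf_eq1 => /orP[/eqP e|/eqP e].
  by rewrite -mulN1r absM e mul1r.
by have := abs_ge0 (-1); rewrite e oppr_ge0 ler10.
Qed.

Lemma abs_distC x y : abs (x - y) = abs (y - x).
Proof. by rewrite -absN opprB. Qed.

Lemma absV x : abs x^-1 = (abs x)^-1.
Proof.
have [->|x0] := eqVneq x 0; first by rewrite invr0 abs0 invr0.
have h : abs x != 0 by rewrite gt_eqF// abs_gt0.
by apply: (mulIf h); rewrite -absM !mulVf// abs1.
Qed.

Lemma absX x n : abs (x ^+ n) = abs x ^+ n.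
Proof. by elim: n => [|n ih]; rewrite ?expr0 ?abs1// !exprS absM ih. Qed.

Lemma abs_ultraD x y r : abs x <= r -> abs y <= r -> abs (x + y) <= r.
Proof.
by move=> xr yr; rewrite (le_trans (nabs_ultra habs x y))// ge_max xr yr.
Qed.

Lemma abs_ultra_ltD x y r : abs x < r -> abs y < r -> abs (x + y) < r.
Proof.
by move=> xr yr; rewrite (le_lt_trans (nabs_ultra habs x y))// gt_max xr yr.
Qed.

Lemma abs_ultraB x y r : abs x <= r -> abs y <= r -> abs (x - y) <= r.
Proof. by move=> xr yr; apply: abs_ultraD => //; rewrite absN. Qed.

(** Otherwise [x = (x - y) + y] would be a sum of two terms smaller than [x]. *)
Lemma abs_dominantB x y : abs y < abs x -> abs (x - y) = abs x.
Proof.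
move=> yx; apply/eqP; rewrite eq_le abs_ultraB ?(ltW yx)//=.
rewrite leNgt; apply/negP => h.
by have := abs_ultra_ltD h yx; rewrite subrK ltxx.
Qed.

(** Picking a point in each coset turns the cardinality of the residue field into
    a covering of the unit ball by [q] disjoint open balls of radius 1. *)
Lemma residue_representatives : exists a : nat -> K,
  [/\ forall i, (i < q)%N -> abs (a i) <= 1,
      forall i j, (i < q)%N -> (j < q)%N -> abs (a i - a j) < 1 -> i = j &
      forall x, abs x <= 1 -> exists2 i, (i < q)%N & abs (x - a i) < 1].
Proof.
have /card_set_bijP[f [fI finj fsurj]] := card_esym (nabs_residue habs).
have /choice[a ha] : forall i : nat, exists a : K,
    (i < q)%N -> abs a <= 1 /\ f i = [set a + p | p in max_ideal abs].
  move=> i; have [iq|] := boolP (i < q)%N; last by exists 0.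
  by have [a a1 fa] := fI i iq; exists a => _; split.
exists a; split=> [i /ha[]//|i j iq jq aij|x x1].
- apply: finj; rewrite ?inE//.
  have [_ ->] := ha _ iq; have [_ ->] := ha _ jq.
  rewrite eqEsubset; split=> _ [p hp <-] /=.
    exists (a i - a j + p); last by ring.
    exact: abs_ultra_ltD.
  exists (a j - a i + p); last by ring.
  by apply: abs_ultra_ltD => //; rewrite abs_distC.
- have [i iq fx] : exists2 i, (i < q)%N & f i = [set x + p | p in max_ideal abs].
    have /fsurj[i iq fi] : residue_field abs [set x + p | p in max_ideal abs].
      by exists x.
    by exists i.
  exists i => //; have [_ ai] := ha _ iq.
  have : [set x + p | p in max_ideal abs] x.
    by exists 0; rewrite ?addr0// /max_ideal /= abs0 ltr01.
  by rewrite -fx ai => -[p hp <-]; rewrite addrC addKr.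
Qed.

(** The residue classes of 0 and 1 are distinct. *)
Lemma q_gt1 : (1 < q)%N.
Proof.
have [a [_ _ hcov]] := residue_representatives.
have [i iq ai] := hcov 0 ltac:(by rewrite abs0 ler01).
have [j jq aj] := hcov 1 ltac:(by rewrite abs1).
rewrite ltnNge; apply/negP => q1.
have := leq_trans iq q1; rewrite ltnS leqn0 => /eqP i0.
have := leq_trans jq q1; rewrite ltnS leqn0 => /eqP j0; subst i j.
have : abs (1 - a 0%N - (0 - a 0%N)) < 1.
  by apply: (abs_ultra_ltD aj); rewrite absN.
by rewrite sub0r opprK subrK abs1 ltxx.
Qed.

Lemma qR_gt1 : 1 < q%:R :> R. Proof. by rewrite ltr1n q_gt1. Qed.
Lemma qR_gt0 : 0 < q%:R :> R. Proof. exact: lt_trans ltr01 qR_gt1. Qed.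
Lemma qR_neq0 : q%:R != 0 :> R. Proof. by rewrite gt_eqF// qR_gt0. Qed.
Lemma lnq_gt0 : 0 < ln q%:R :> R. Proof. by rewrite ln_gt0// qR_gt1. Qed.

Lemma uniformizer : exists2 pi : K, pi != 0 & abs pi = q%:R^-1.
Proof.
have [pi _ api] := nabs_uniformizer habs.
by exists pi => //; rewrite -abs_gt0 api invr_gt0 qR_gt0.
Qed.

Lemma abs_gap1 x : abs x < 1 -> abs x <= q%:R^-1.
Proof.
have [pi mpi api] := nabs_uniformizer habs => x1.
have : max_ideal abs x by [].
by rewrite mpi => -[y y1 <-]; rewrite absM api ler_piMr.
Qed.

(** The values of [abs] are discrete: an element of the maximal ideal is a
    multiple of the uniformizer, hence no value lies strictly between
    [abs y / q%:R] and [abs y]. *)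
Lemma abs_gap x y : abs x < abs y -> abs x <= abs y / q%:R.
Proof.
move=> xy; have y0 : 0 < abs y by exact: le_lt_trans (abs_ge0 x) xy.
have : abs (x / y) < 1 by rewrite absM absV ltr_pdivrMr// mul1r.
by move=> /abs_gap1; rewrite absM absV ler_pdivrMr// mulrC.
Qed.

Lemma expqV_lt (e : R) : 0 < e -> exists n, q%:R ^- n < e.
Proof.
move=> e0; have : q%:R^-1 ^+ n @[n --> \oo] --> (0 : R).
  by apply: cvg_expr; rewrite ger0_norm// invf_lt1 ?qR_gt1 ?qR_gt0.
move=> /cvgr_dist_lt /(_ _ e0)[n _ /(_ n (leqnn n))].
by rewrite sub0r normrN ger0_norm ?exprn_ge0// exprVn; exists n.
Qed.

(** Take the least [n] such that [q%:R ^- n.+1 < abs x]: by minimality and by the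
    gap between consecutive powers, [abs x] is squeezed onto [q%:R ^- n]. *)
Lemma abs_le1_val x : x != 0 -> abs x <= 1 -> exists n, abs x = q%:R ^- n.
Proof.
move=> x0 x1; have [pi pi0 api] := uniformizer.
have ex : exists n, q%:R ^- n < abs x by apply: expqV_lt; rewrite abs_gt0.
case: (ex_minnP ex) => -[|n] hn hmin.
  by move: hn; rewrite expr0 invr1 ltNge x1.
exists n; apply/eqP; rewrite eq_le; apply/andP; split.
  by rewrite leNgt; apply/negP => /hmin; rewrite ltnn.
rewrite leNgt; apply/negP => h.
have : abs x <= abs (pi ^+ n) / q%:R.
  by apply: abs_gap; rewrite absX api exprVn.
rewrite absX api exprVn -invfM -exprSr => h'.
by have := lt_le_trans hn h'; rewrite ltxx.
Qed.

Lemma abs_val c x : x != 0 -> c != 0 ->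
  abs x <= abs c -> exists n, abs x = abs c / q%:R ^+ n.
Proof.
move=> x0 c0 xc; have ac : 0 < abs c by rewrite abs_gt0.
have [||n hn] := @abs_le1_val (x / c).
- by rewrite mulf_neq0// invr_eq0.
- by rewrite absM absV ler_pdivrMr// mul1r.
exists n; rewrite -hn absM absV mulrC divfK//; exact: lt0r_neq0.
Qed.

End absolute_value_theory.

(** * Balls, separability and Borel measurability *)

Section topology.
Context {R : realType} {K : nonArchLocalFieldType} (abs : K -> R) (q : nat).
Hypothesis habs : normalized_abs abs q.
Implicit Types (x y c t : K) (n : nat).

Definition cball x (r : R) : set K := [set y | abs (y - x) <= r].

Lemma open_absP (A : set K) :
  open A <-> forall x, A x -> exists2 r, 0 < r & [set y | abs (y - x) < r] `<=` A.
Proof.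
rewrite openE /interior; split=> h x Ax.
  exact: (nabs_nbhs habs x A).1 (h x Ax).
exact: (nabs_nbhs habs x A).2 (h x Ax).
Qed.

Lemma open_abs_lt x r : open [set y | abs (y - x) < r].
Proof.
apply/open_absP => y /= yr; exists r; first exact: le_lt_trans (abs_ge0 habs _) yr.
move=> z /= zy; rewrite (_ : z - x = (z - y) + (y - x)); last by ring.
exact: (abs_ultra_ltD habs).
Qed.

Lemma cball_eq x y r : cball x r y -> cball y r = cball x r.
Proof.
rewrite /cball /= => xy; rewrite eqEsubset; split=> z /= zr.
  have -> : z - x = (z - y) + (y - x) by ring.
  exact: (abs_ultraD habs).
have -> : z - y = (z - x) - (y - x) by ring.
exact: (abs_ultraB habs).
Qed.

Lemma open_measurable_borel (A : set K) : open A -> measurable (A : set (borel K)).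
Proof. exact: sub_gen_smallest. Qed.

Lemma measurable_abs_lt r : measurable ([set t | abs t < r] : set (borel K)).
Proof.
apply: open_measurable_borel; have := open_abs_lt 0 r.
by congr open; apply/seteqP; split=> y /=; rewrite subr0.
Qed.

(** A point [y] outside the ball keeps its distance to [x] on the whole open ball
    of radius [abs (y - x)] around [y]. *)
Lemma closed_cball x r : closed (cball x r).
Proof.
have [r0|r0] := ltP r 0.
  rewrite (_ : cball x r = set0); first exact: closed0.
  apply/seteqP; split=> // y.
  by rewrite /cball /= leNgt (lt_le_trans r0)// (abs_ge0 habs).
rewrite -[cball x r]setCK; apply: open_closedC; apply/open_absP => y /=.
rewrite /cball /= => /negP; rewrite -ltNge => ry.
exists (abs (y - x)); first exact: le_lt_trans ry.
move=> z /= zy; apply/negP; rewrite -ltNge.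
rewrite (_ : z - x = (y - x) - (y - z)); last by ring.
by rewrite (abs_dominantB habs)// (abs_distC habs).
Qed.

Lemma measurable_cball x r : measurable (cball x r : set (borel K)).
Proof.
rewrite -[cball x r]setCK; apply: measurableC.
by apply: open_measurable_borel; apply: closed_openC; exact: closed_cball.
Qed.

Lemma measurable_fun_lt_level d (T : measurableType d) (f : T -> R) :
  (forall r, measurable [set t | f t < r]) -> measurable_fun setT f.
Proof.
move=> h; apply: (measurability _ (RGenCInfty.measurableE R)) => A [B [r ->]] <-.
rewrite setTI (_ : _ @^-1` _ = ~` [set t | f t < r]); first exact: measurableC.
apply/seteqP; split=> t /=; rewrite in_itv/= andbT leNgt => /negP//.
Qed.

Lemma measurable_abs : measurable_fun setT (abs : borel K -> R).
Proof. by apply: measurable_fun_lt_level => r; exact: measurable_abs_lt. Qed.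

Lemma measurable_affine x c : 
  measurable_fun setT (fun t : borel K => (x + c * t : K) : borel K).
Proof.
apply: (@measurability _ _ (borel K) (borel K) setT _
  (@open K : set (set (borel K)))) => // _ [A oA <-].
rewrite setTI; apply: open_measurable_borel; apply/open_absP => y /= Ay.
have [r r0 rA] := (open_absP A).1 oA _ Ay.
exists (r / (1 + abs c)).
  by rewrite divr_gt0// ltr_wpDr// (abs_ge0 habs).
move=> z /=; rewrite ltr_pdivlMr; last by rewrite ltr_wpDr// (abs_ge0 habs).
move=> zy; apply: rA => /=; have -> : x + c * z - (x + c * y) = c * (z - y) by ring.
rewrite (absM habs) mulrC; apply: le_lt_trans zy.
by rewrite ler_wpM2l ?(abs_ge0 habs)// lerDr.
Qed.

(** A net at scale [n] is copied into each residue class, which a translation and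
    a division by the uniformizer identify with the unit ball. *)
Lemma finite_net_unit_ball n : exists s : seq K,
  forall x, abs x <= 1 -> exists2 a, a \in s & abs (x - a) <= q%:R ^- n.
Proof.
have [a [a1 _ acov]] := residue_representatives habs.
have [pi pi0 api] := uniformizer habs.
elim: n => [|n [s ih]].
  exists [:: 0] => x x1; exists 0; rewrite ?inE//.
  by rewrite subr0 expr0 invr1.
exists [seq a i + pi * b | i <- iota 0 q, b <- s] => x /acov[i iq xi].
have [|b bs hb] := ih ((x - a i) / pi).
  rewrite (absM habs) (absV habs) api invrK -ler_pdivlMr ?(qR_gt0 habs)// mul1r.
  exact: (abs_gap1 habs).
exists (a i + pi * b).
  by apply: allpairs_f => //; rewrite mem_iota.
have -> : x - (a i + pi * b) = pi * ((x - a i) / pi - b) by field.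
rewrite (absM habs) api exprS invfM ler_wpM2l//.
Qed.

(** Nets of the unit ball, rescaled by powers of the uniformizer. Separability is
    used twice: to write open sets as countable unions of balls, and to make
    the distance measurable for the product of the Borel sigma-algebras. *)
Lemma countable_dense : exists C : nat -> K,
  forall x r, 0 < r -> exists k, abs (x - C k) < r.
Proof.
have [pi pi0 api] := uniformizer habs.
have /choice[s hs] := finite_net_unit_ball.
pose C k := if unpickle k is Some (n, m, i) then pi ^- m * nth 0 (s n) i else 0.
exists C => x r r0.
have [m hm] : exists m, abs (pi ^+ m * x) <= 1.
  have h0 : 0 < 1 + abs x by rewrite ltr_wpDr// (abs_ge0 habs).
  have [m hm] : exists m, q%:R ^- m < (1 + abs x)^-1.
    by apply: (expqV_lt habs); rewrite invr_gt0.
  exists m; rewrite (absM habs) (absX habs) api exprVn.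
  apply: (@le_trans _ _ ((1 + abs x)^-1 * abs x)).
    by rewrite ler_wpM2r ?(abs_ge0 habs)// ltW.
  by rewrite ler_pdivrMl// mulr1 lerDr.
have qm0 : 0 < q%:R ^+ m :> R by rewrite exprn_gt0// (qR_gt0 habs).
have [n hn] := expqV_lt habs (divr_gt0 r0 qm0).
have [a asn ha] := hs n _ hm.
exists (pickle (n, m, index a (s n))).
rewrite /C pickleK nth_index//.
have -> : x - pi ^- m * a = pi ^- m * (pi ^+ m * x - a).
  by field; rewrite expf_neq0.
rewrite (absM habs) (absV habs) (absX habs) api exprVn invrK.
by rewrite mulrC -ltr_pdivlMr//; exact: le_lt_trans hn.
Qed.

(** Two points are at distance less than [r] if and only if they lie in a common
    ball of radius [r] centred at a point of the dense sequence. *)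
Lemma measurable_absB :
  measurable_fun setT (fun z : borel K * borel K => abs ((z.1 : K) - z.2)).
Proof.
apply: measurable_fun_lt_level => r.
have [C hC] := countable_dense.
have [r0|r0] := leP r 0.
  rewrite (_ : [set _ | _] = set0)//; apply/seteqP; split=> // z /=.
  by rewrite ltNge (le_trans r0)// (abs_ge0 habs).
pose B k : set (borel K) := [set y : K | abs (y - C k) < r].
rewrite (_ : [set _ | _] = \bigcup_k (B k `*` B k)).
  apply: bigcupT_measurable => k.
  by apply: measurableX; apply: open_measurable_borel; exact: open_abs_lt.
apply/seteqP; split=> -[y z] /=.
  move=> yz; have [k zk] := hC z _ r0; exists k => //; split => //=.
  rewrite /B /=; have -> : y - C k = (y - z) + (z - C k) by ring.
  exact: (abs_ultra_ltD habs).
move=> [k _ [/= yk zk]]; have -> : (y : K) - z = (y - C k) - (z - C k) by ring.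
by apply: (abs_ultra_ltD habs) => //; rewrite (absN habs).
Qed.

End topology.

(** * Haar measure of balls and its behaviour under affine maps *)

Section haar.
Context {R : realType} {K : nonArchLocalFieldType} (abs : K -> R) (q : nat).
Hypothesis habs : normalized_abs abs q.
Variable mu : {measure set (borel K) -> \bar R}.
Hypothesis hmu : normalized_haar abs mu.
Implicit Types (x y c t : K) (n : nat).
Local Notation cball := (cball abs).

Lemma mu_cball_center x r : mu (cball x r) = mu (cball 0 r).
Proof.
rewrite -(haar_translation hmu x (measurable_cball habs 0 r)); congr (mu _).
apply/seteqP; split=> [y yr|_ [y yr <-]].
  by exists (y - x); [rewrite /cball /= subr0|rewrite addrC subrK].
by rewrite /cball /= addrAC subrr add0r; move: yr; rewrite /cball /= subr0.
Qed.

(** The ball of radius [abs c] splits into [q] translates of the ball of the next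
    smaller radius, one for each residue class. *)
Lemma mu_cball_step c : c != 0 ->
  mu (cball 0 (abs c)) = (q%:R%:E * mu (cball 0%R (abs c / q%:R)%R))%E.
Proof.
move=> c0; have ac0 : 0 < abs c by rewrite (abs_gt0 habs).
have [a [a1 ainj acov]] := residue_representatives habs.
have q0 := qR_gt0 habs.
have -> : cball 0 (abs c) = \bigcup_(i in `I_q) cball (c * a i) (abs c / q%:R).
  apply/seteqP; split=> [y|y [i /= iq]].
    rewrite /cball /= subr0 => yc; have [|i iq hi] := acov (y / c).
      by rewrite (absM habs) (absV habs) ler_pdivrMr ?mul1r.
    exists i => //=; have -> : y - c * a i = c * (y / c - a i) by field.
    by rewrite (absM habs) ler_wpM2l ?(ltW ac0)//; exact: (abs_gap1 habs).
  rewrite /cball /= subr0 => yi; have -> : y = (y - c * a i) + c * a i by ring.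
  apply: (abs_ultraD habs).
    by rewrite (le_trans yi)// ler_pdivrMr// ler_pMr// ltW// (qR_gt1 habs).
  by rewrite (absM habs) ler_piMr ?(ltW ac0) ?a1.
rewrite measure_fin_bigcup//.
- rewrite (eq_fsbigr (fun=> mu (cball 0 (abs c / q%:R)))); last first.
    by move=> i _; exact: mu_cball_center.
  by rewrite -fsbig_ord sumr_const card_ord /= mule_natl.
- apply/trivIsetP => i j /= iq jq ij; apply/seteqP; split=> // y [].
  rewrite /cball /= => yi yj; move/eqP: ij; apply; apply: ainj => //.
  have : abs (c * (a i - a j)) <= abs c / q%:R.
    rewrite (_ : c * _ = (y - c * a j) - (y - c * a i)); last by ring.
    exact: (abs_ultraB habs).
  rewrite (absM habs) ler_pM2l// => /le_lt_trans; apply.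
  by rewrite invf_lt1// (qR_gt1 habs).
- by move=> i _; exact: (measurable_cball habs).
Qed.

Lemma mu_cball_expV n : mu (cball 0 (q%:R ^- n)) = (q%:R ^- n)%:E.
Proof.
have [pi pi0 api] := uniformizer habs; have q0 := qR_gt0 habs.
elim: n => [|n ih].
  rewrite expr0 invr1 -(haar_int_ring hmu); congr (mu _).
  by apply/seteqP; split=> y; rewrite /cball /int_ring /= subr0.
have e : abs (pi ^+ n) = q%:R ^- n by rewrite (absX habs) api exprVn.
have := mu_cball_step (_ : pi ^+ n != 0); rewrite expf_neq0// => /(_ isT).
rewrite e ih -invfM -exprSr.
case: (mu _) => [r| |].
- move=> [h]; congr EFin; apply: (mulfI (lt0r_neq0 q0)).
  by rewrite -h exprS invfM mulrA mulfV ?mul1r// lt0r_neq0.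
- by rewrite gt0_muley// lte_fin.
- by rewrite gt0_muleNy// lte_fin.
Qed.

Lemma mu_cball_exp n : mu (cball 0 (q%:R ^+ n)) = (q%:R ^+ n)%:E.
Proof.
have [pi pi0 api] := uniformizer habs; have q0 := qR_gt0 habs.
elim: n => [|n ih]; first by have := mu_cball_expV 0; rewrite expr0 invr1.
have e : abs (pi ^- n.+1) = q%:R ^+ n.+1.
  by rewrite (absV habs) (absX habs) api exprVn invrK.
have := mu_cball_step (_ : pi ^- n.+1 != 0).
rewrite invr_eq0 expf_neq0// => /(_ isT); rewrite e => ->.
by rewrite [in LHS]exprSr mulfK ?lt0r_neq0// ih -EFinM exprS.
Qed.

Lemma mu_cball x c : c != 0 -> mu (cball x (abs c)) = (abs c)%:E.
Proof.
move=> c0; rewrite mu_cball_center.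
have [c1|/ltW c1] := leP (abs c) 1.
  by have [n ->] := abs_le1_val habs c0 c1; exact: mu_cball_expV.
have : exists n, abs 1 = abs c / q%:R ^+ n.
  by apply: (abs_val habs); rewrite ?oner_eq0// (abs1 habs).
rewrite (abs1 habs) => -[n h]; have -> : abs c = q%:R ^+ n.
  have qn : q%:R ^+ n != 0 :> R by rewrite expf_neq0// (qR_neq0 habs).
  by rewrite -[LHS](divfK qn) -h mul1r.
exact: mu_cball_exp.
Qed.

Lemma mu_sphere c : c != 0 ->
  mu [set t | abs t = abs c] = (abs c * (1 - q%:R^-1))%:E.
Proof.
move=> c0; have [pi pi0 api] := uniformizer habs.
have ac0 : 0 < abs c by rewrite (abs_gt0 habs).
have e : abs c / q%:R = abs (c * pi) by rewrite (absM habs) api.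
have -> : [set t | abs t = abs c] = cball 0 (abs c) `\` cball 0 (abs c / q%:R).
  apply/seteqP; split=> t; rewrite /cball /= !subr0.
    move=> ->; split=> //; apply/negP; rewrite -ltNge ltr_pdivrMr ?(qR_gt0 habs)//.
    by rewrite ltr_pMr// (qR_gt1 habs).
  move=> [tc /negP h]; apply/eqP; rewrite eq_le tc /= leNgt; apply: contra h.
  exact: (abs_gap habs).
rewrite measureD ?(setIidr _) //; try exact: (measurable_cball habs).
- rewrite [X in (X - _)%E](mu_cball 0 c0) e [X in (_ - X)%E]mu_cball ?mulf_neq0//.
  by rewrite -EFinB -e mulrBr mulr1.
- move=> t; rewrite /cball /= => h; rewrite (le_trans h)//.
  by rewrite ler_pdivrMr ?(qR_gt0 habs)// ler_pMr// ltW// (qR_gt1 habs).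
- by rewrite [ltLHS]mu_cball// ltry.
Qed.

Lemma measurable_sphere c : measurable ([set t | abs t = abs c] : set (borel K)).
Proof.
have := measurable_abs habs measurableT (measurable_set1 (abs c)).
by rewrite setTI.
Qed.

Lemma cball0 x : cball x 0 = [set x].
Proof.
apply/seteqP; split=> y; rewrite /cball /=; last first.
  by move=> ->; rewrite subrr (abs0 habs).
move=> h; apply/eqP; rewrite -subr_eq0; apply: contraLR h.
by rewrite -(abs_gt0 habs) -ltNge.
Qed.

Lemma measurable_point x : measurable ([set x] : set (borel K)).
Proof. rewrite -cball0; exact: (measurable_cball habs). Qed.

Lemma mu_point x : mu [set x] = 0%E.
Proof.
apply/eqP; rewrite eq_le measure_ge0 andbT.
apply/lee_addgt0Pr => e e0; rewrite add0e.
have [n hn] := expqV_lt habs e0.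
rewrite -cball0 mu_cball_center; apply: (@le_trans _ _ (mu (cball 0 (q%:R ^- n)))).
  apply: le_measure; rewrite ?inE; try exact: (measurable_cball habs).
  move=> y; rewrite /cball /= => h; apply: le_trans h _.
  by rewrite invr_ge0 exprn_ge0.
by rewrite mu_cball_expV lee_fin ltW.
Qed.

Lemma cball_cover : \bigcup_k cball 0 (q%:R ^+ k) = [set: K].
Proof.
apply/seteqP; split=> // x _.
have h0 : 0 < 1 + abs x by rewrite ltr_wpDr// (abs_ge0 habs).
have [m hm] : exists m, q%:R ^- m < (1 + abs x)^-1.
  by apply: (expqV_lt habs); rewrite invr_gt0.
exists m => //; rewrite /cball /= subr0.
move: hm; rewrite ltf_pV2 ?posrE ?exprn_gt0 ?(qR_gt0 habs)// => hm.
by rewrite ltW// (le_lt_trans _ hm)// lerDr.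
Qed.

Lemma haar_sigma_finite : sigma_finite setT mu.
Proof.
exists (fun k => cball 0 (q%:R ^+ k)); first by rewrite cball_cover.
by move=> k; split; [exact: (measurable_cball habs)|rewrite mu_cball_exp ltry].
Qed.

(** Two ultrametric balls are nested or disjoint, so that the empty set is all
    that must be added to the balls to close them under intersection. *)
Definition ball_system : set (set K) :=
  [set A | A = set0 \/ exists x c, c != 0 /\ A = cball x (abs c)].

Lemma ball_system_setI : setI_closed ball_system.
Proof.
move=> A B [->|[x [c [c0 ->]]]]; first by rewrite set0I; left.
move=> [->|[y [d [d0 ->]]]]; first by rewrite setI0; left.
have [[z [zx zy]]|h] := pselect ((cball x (abs c) `&` cball y (abs d)) !=set0).
  right; have [cd|/ltW cd] := leP (abs c) (abs d).
    exists x, c; split => //; apply: setIidl => t tx.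
    have /(cball_eq habs) <- := zy.
    rewrite -(cball_eq habs zx) in tx.
    by move: tx; rewrite /cball /= => /le_trans; apply.
  exists y, d; split => //; apply: setIidr => t ty.
  have /(cball_eq habs) <- := zx.
  rewrite -(cball_eq habs zy) in ty.
  by move: ty; rewrite /cball /= => /le_trans; apply.
left; apply/seteqP; split=> // z hz; apply: h; by exists z.
Qed.

(** An open set is the union of the countably many balls contained in it whose
    centre belongs to the dense sequence and whose radius is a power of [q]. *)
Lemma borel_generated_by_balls (E : set K) :
  measurable (E : set (borel K)) -> <<s ball_system >> E.
Proof.
apply: smallest_sub; first exact: smallest_sigma_algebra.
move=> A /(open_absP habs) oA.
have [C hC] := countable_dense habs.
have [pi pi0 api] := uniformizer habs.
pose F k n := if `[< cball (C k) (q%:R ^- n) `<=` A >]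
              then cball (C k) (q%:R ^- n) else set0.
have -> : A = \bigcup_k \bigcup_n F k n.
  apply/seteqP; split=> [x Ax|x [k _ [n _]]]; last first.
    by rewrite /F; case: ifPn => // /asboolP; apply.
  have [r r0 rA] := oA _ Ax.
  have [n hn] := expqV_lt habs r0.
  have qn0 : 0 < q%:R ^- n :> R by rewrite invr_gt0 exprn_gt0// (qR_gt0 habs).
  have [k hk] := hC x _ qn0.
  exists k => //; exists n => //; rewrite /F; case: ifPn => [_|/asboolP[]].
    by rewrite /cball /= ltW.
  have xk : cball (C k) (q%:R ^- n) x by rewrite /cball /= ltW.
  rewrite -(cball_eq habs xk) => y; rewrite /cball /= => yx; apply: rA => /=.
  exact: le_lt_trans hn.
have mF k n : <<s ball_system >> (F k n).
  apply: sub_sigma_algebra; rewrite /F; case: ifPn => _; last by left.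
  by right; exists (C k), (pi ^+ n); rewrite expf_neq0// (absX habs) api exprVn.
apply: (@bigcupT_measurable _ (g_sigma_algebraType
  (ball_system : set (set (pointed_carrier K))))) => k.
by apply: (@bigcupT_measurable _ (g_sigma_algebraType
  (ball_system : set (set (pointed_carrier K))))) => n; exact: mF.
Qed.

(** The preimage of a ball of radius [r] is a ball of radius [r / abs c], so both
    sides agree on balls; measures that agree on a generating system closed
    under intersection and finite on an exhausting sequence of it are equal. *)
Lemma mu_preimage_affine x c (A : set (borel K)) : c != 0 -> measurable A ->
  mu ((fun t : borel K => (x + c * t : K)) @^-1` A) = ((abs c)^-1%:E * mu A)%E.
Proof.
move=> c0 mA.
have mT := measurable_affine habs x c.
pose T := (fun t : borel K => (x + c * t : K) : borel K).
have ac0 : 0 < abs c by rewrite (abs_gt0 habs).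
have k0 : 0 <= (abs c)^-1 by rewrite invr_ge0 ltW.
have HT B : ball_system B -> mu (T @^-1` B) = ((abs c)^-1%:E * mu B)%E.
  move=> [->|[y [d [d0 ->]]]]; first by rewrite preimage_set0 measure0 mule0.
  have -> : T @^-1` cball y (abs d) = cball ((y - x) / c) (abs (d / c)).
    apply/seteqP; split=> t; rewrite /cball /T /= (absM habs d);
      rewrite (absV habs) ler_pdivlMr//;
      rewrite -(absM habs); congr (abs _ <= _); by field.
  by rewrite !mu_cball ?mulf_neq0 ?invr_eq0// (absM habs) (absV habs) mulrC.
pose m1 : {measure set (borel K) -> \bar R} :=
  measure_function_pushforward__canonical__measure_function_Measure mu mT.
pose m2 : {measure set (borel K) -> \bar R} := mscale (NngNum k0) mu.
have GM : (ball_system : set (set (borel K))) `<=` measurable.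
  move=> B [->|[y [d [d0 ->]]]]; first exact: measurable0.
  exact: (measurable_cball habs).
have [pi pi0 api] := uniformizer habs.
have gB k : ball_system (cball 0 (q%:R ^+ k)).
  right; exists 0, (pi ^- k).
  by rewrite invr_eq0 expf_neq0// (absV habs) (absX habs) api exprVn invrK.
apply: (g_sigma_algebra_measure_unique _ GM _ gB cball_cover m1 m2
  ball_system_setI HT) => [k|].
  rewrite [ltLHS](HT _ (gB k)) mu_cball_exp -EFinM ltry//.
exact: borel_generated_by_balls.
Qed.

End haar.

(** * Affine changes of variables and radial integrals *)

Section integration.
Context {R : realType} {K : nonArchLocalFieldType} (abs : K -> R) (q : nat).
Hypothesis habs : normalized_abs abs q.
Variable mu : {measure set (borel K) -> \bar R}.
Hypothesis hmu : normalized_haar abs mu.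
Implicit Types (x y c t : K) (n : nat).
Local Open Scope ereal_scope.

Lemma ge0_integral_affine x c (f : borel K -> \bar R) : (c != 0)%R ->
  measurable_fun setT f -> (forall t, 0 <= f t) ->
  \int[mu]_t f (x + c * (t : K))%R = (abs c)^-1%:E * \int[mu]_t f t.
Proof.
move=> c0 mf f0.
have mT := measurable_affine habs x c.
have k0 : (0 <= (abs c)^-1)%R by rewrite invr_ge0 (abs_ge0 habs).
have := @ge0_integral_pushforward _ _ (borel K) (borel K) R _ mT mu setT f
  measurableT mf (fun t _ => f0 t).
rewrite preimage_setT /comp => <-.
rewrite -(@ge0_integral_mscale _ _ _ mu setT measurableT (NngNum k0) f mf)//.
apply: eq_measure_integral => A mA _.
exact: (mu_preimage_affine habs hmu).
Qed.

Lemma integrable_affine x c (f : borel K -> \bar R) : (c != 0)%R ->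
  mu.-integrable setT f ->
  mu.-integrable setT (fun t => f (x + c * (t : K))%R).
Proof.
move=> c0 /integrableP[mf fi]; apply/integrableP; split.
  exact: (measurableT_comp mf (measurable_affine habs x c)).
rewrite (ge0_integral_affine x (f := fun t => `|f t|))//; last first.
  exact: measurableT_comp.
by rewrite lte_mul_pinfty// lee_fin invr_ge0 (abs_ge0 habs).
Qed.

Lemma integral_affine x c (f : borel K -> \bar R) : (c != 0)%R ->
  mu.-integrable setT f ->
  \int[mu]_t f (x + c * (t : K))%R = (abs c)^-1%:E * \int[mu]_t f t.
Proof.
move=> c0 fi; have [mf _] := integrableP _ _ _ fi.
rewrite integralE [in RHS]integralE.
under eq_integral do
  rewrite (funepos_comp f (fun t : borel K => (x + c * (t : K))%R))/=.
under [X in _ - X]eq_integral do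
  rewrite (funeneg_comp f (fun t : borel K => (x + c * (t : K))%R))/=.
rewrite !ge0_integral_affine//;
  [|exact: measurable_funeneg|exact: measurable_funepos].
rewrite [RHS]muleBr//; apply: fin_num_adde_defr.
exact: (integrable_pos_fin_num measurableT fi).
Qed.

Lemma integral_sphere (f : borel K -> \bar R) (r : R) c : (c != 0)%R ->
  (forall t, abs t = abs c -> f t = r%:E) ->
  \int[mu]_(t in [set t : K | abs t = abs c]) f t =
  (r * (abs c * (1 - q%:R^-1)))%:E.
Proof.
move=> c0 fr.
transitivity (\int[mu]_(t in [set t : K | abs t = abs c]) (cst r%:E) t).
  by apply: eq_integral => t /[!inE] /fr.
rewrite integral_cst; last exact: (measurable_sphere habs).
by rewrite [X in _ * X](mu_sphere habs hmu).
Qed.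

(** The sphere through [s n] has measure [abs (s n) * (1 - q%:R^-1)], whence a
    series. The value of [g] at 0 is left free since points are null sets. *)
Lemma ge0_integral_spheres (s : nat -> K) (g : K -> R) (a b x : R) :
  (0 < x)%R -> (x < 1)%R ->
  (forall n, s n != 0)%R -> injective (abs \o s) ->
  measurable_fun setT (g : borel K -> R) -> (forall t, 0 <= g t)%R ->
  (forall n t, abs t = abs (s n) ->
     g t * abs t = (a + b * n%:R) * x ^+ n)%R ->
  (forall t, t != 0 -> (forall n, abs t <> abs (s n)) -> g t = 0)%R ->
  \int[mu]_t (g t)%:E =
  ((1 - q%:R^-1) * (a / (1 - x) + b * x / (1 - x) ^+ 2))%:E.
Proof.
move=> x0 x1 s0 sinj mg g0 gs g00.
pose S n : set (borel K) := [set t : K | abs t = abs (s n)].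
have mS n : measurable (S n) by exact: (measurable_sphere habs).
have meg : measurable_fun setT (fun t : borel K => (g t)%:E).
  exact/measurable_EFinP.
rewrite (@ge0_negligible_integral _ _ _ mu setT [set (0%R : K)])//; last 3 first.
- exact: (measurable_point habs).
- by move=> t _; rewrite lee_fin.
- exact: (mu_point habs hmu).
transitivity (\int[mu]_(t in \bigcup_n S n) (g t)%:E).
  rewrite integral_mkcond [RHS]integral_mkcond; apply: eq_integral => t _.
  rewrite /patch; case: ifPn => [|/negP].
    rewrite inE /= => -[_ /eqP t0]; case: ifPn => // /negP; rewrite inE => h.
    by rewrite g00// => n tn; apply: h; exists n.
  rewrite inE /= => h; case: ifPn => //; rewrite inE => -[n _ tn].
  exfalso; apply: h; split=> //; rewrite /S /= in tn => t0.
  by have := s0 n; rewrite -(abs_gt0 habs) -tn t0 (abs0 habs) ltxx.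
rewrite ge0_integral_bigcup//; last 3 first.
- exact: measurable_funTS.
- by move=> t _; rewrite lee_fin.
- apply/trivIsetP => i j _ _ ij; apply/seteqP; split=> // t [].
  rewrite /S /= => -> h; move/eqP : ij; apply; exact: sinj.
transitivity (\sum_(n <oo) (1 - q%:R^-1)%:E * ((a + b * n%:R) * x ^+ n)%:E).
  apply: eq_eseriesr => n _.
  have sn0 : (abs (s n) != 0)%R by rewrite gt_eqF// (abs_gt0 habs).
  rewrite (integral_sphere (r := (a + b * n%:R) * x ^+ n / abs (s n)) (s0 n)).
    by rewrite -EFinM; congr EFin; field; rewrite sn0 (qR_neq0 habs).
  by move=> t tn; rewrite -(gs _ _ tn) tn mulfK.
rewrite nneseriesZl.
  by rewrite nneseries_arithmetico_geometric.
move=> n _; rewrite lee_fin; rewrite -(gs n (s n))// mulr_ge0//.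
exact: (abs_ge0 habs).
Qed.

Lemma spheres_inj c (pi : K) : (c != 0)%R -> (pi != 0)%R ->
  (abs pi = q%:R^-1)%R -> injective (abs \o (fun n => c * pi ^+ n)%R).
Proof.
move=> c0 pi0 api m n /=; rewrite !(absM habs) !(absX habs) api => h.
have ac0 : (abs c != 0)%R by rewrite gt_eqF// (abs_gt0 habs).
have := mulfI ac0 h; apply: ieexprIn.
- by rewrite invr_gt0 (qR_gt0 habs).
- by rewrite invr_eq1 gt_eqF// (qR_gt1 habs).
Qed.

Lemma continuous_affine x c : continuous (fun t : K => x + c * t)%R.
Proof.
move=> t A /(nabs_nbhs habs)[r r0 rA]; apply/(nabs_nbhs habs).
have h0 : (0 < 1 + abs c)%R by rewrite ltr_wpDr// (abs_ge0 habs).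
exists (r / (1 + abs c))%R; first by rewrite divr_gt0.
move=> z /=; rewrite ltr_pdivlMr// => zt; apply: rA => /=.
have -> : (x + c * z - (x + c * t) = c * (z - t))%R by ring.
rewrite (absM habs) mulrC; apply: le_lt_trans zt.
by rewrite ler_wpM2l ?(abs_ge0 habs)// lerDr.
Qed.

(** A small ball around 0 is closed in a compact neighbourhood of 0, and every
    ball is an affine image of it. *)
Lemma compact_cball x c : (c != 0)%R -> compact (cball abs x (abs c)).
Proof.
move=> c0; have [pi pi0 api] := uniformizer habs.
have [U U0 [cU _]] := @nalf_locally_compact K 0%R I.
have {}U0 : nbhs (0%R : K) U.
  by move: U0; rewrite /within /=; apply: filterS => t; exact.
have [r r0 rU] := (nabs_nbhs habs _ _).1 U0.
have [n hn] := expqV_lt habs r0.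
have qn0 : (0 < q%:R ^- n :> R)%R by rewrite invr_gt0 exprn_gt0// (qR_gt0 habs).
have cB : compact (cball abs 0%R (q%:R ^- n)).
  apply: subclosed_compact cU _; first exact: (closed_cball habs).
  by move=> t th; apply: rU; rewrite /cball /= in th *; exact: le_lt_trans hn.
have api' : abs (pi ^+ n)%R = (q%:R ^- n)%R by rewrite (absX habs) api exprVn.
have -> : cball abs x (abs c) =
    [set (x + c / pi ^+ n * t)%R | t in cball abs 0%R (q%:R ^- n)].
  apply/seteqP; split=> [y|_ [t + <-]]; rewrite /cball /=.
    move=> yc; exists (pi ^+ n / c * (y - x))%R; last first.
      by field; rewrite c0 expf_neq0.
    rewrite subr0 !(absM habs) (absV habs) api' -mulrA ger_pMr//.
    by rewrite mulrC ler_pdivrMr ?mul1r// (abs_gt0 habs).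
  rewrite subr0 addrAC subrr add0r !(absM habs) (absV habs) api' => th.
  rewrite -mulrA ger_pMr ?(abs_gt0 habs)// mulrC ler_pdivrMr ?mul1r//.
apply: continuous_compact cB.
by apply: continuous_subspaceT; exact: continuous_affine.
Qed.

End integration.

(** * The kernel of the truncated operator *)

Section kernels.
Context {R : realType} {K : nonArchLocalFieldType} (abs : K -> R) (q : nat).
Hypothesis habs : normalized_abs abs q.
Variable mu : {measure set (borel K) -> \bar R}.
Hypothesis hmu : normalized_haar abs mu.
Variable eps : R.
Hypothesis eps0 : 0 < eps.
Implicit Types (x y c t w : K) (n : nat).

(** The positive part of [ln (r / rho)], with the convention 0 at [rho = 0]. *)
Definition log_gap (r rho : R) : R :=
  if (0 < rho) && (rho < r) then ln r - ln rho else 0.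

Lemma log_gap_ge0 r rho : 0 <= log_gap r rho.
Proof.
rewrite /log_gap; case: ifP => // /andP[r0 rr].
by rewrite subr_ge0 ler_ln ?posrE ?(ltW rr)// (lt_trans r0).
Qed.

Lemma log_gap_le r rho : 0 < rho -> rho <= r -> log_gap r rho = ln r - ln rho.
Proof.
rewrite le_eqVlt => r0 /predU1P[->|rr]; first by rewrite /log_gap ltxx andbF subrr.
by rewrite /log_gap r0 rr.
Qed.

Lemma log_gap_ge r rho : r <= rho -> log_gap r rho = 0.
Proof. by rewrite /log_gap leNgt => /negbTE ->; rewrite andbF. Qed.

Lemma measurable_log_gap d (T : measurableType d) (f g : T -> R) :
  measurable_fun setT f -> measurable_fun setT g ->
  measurable_fun setT (fun z => log_gap (f z) (g z)).
Proof.
move=> mf mg; apply: measurable_fun_ifT => //.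
  by apply: measurable_and; apply: measurable_fun_ltr.
by apply: measurable_funB; exact: measurableT_comp.
Qed.

Lemma measurable_funV_ge0 d (T : measurableType d) (f : T -> R) :
  (forall z, 0 <= f z) -> measurable_fun setT f ->
  measurable_fun setT (fun z => (f z)^-1).
Proof.
move=> f0 mf; under eq_fun do rewrite -powR_inv1//.
exact: (measurableT_comp (measurable_powR (-1)) mf).
Qed.

(** The contributions of [abs w < abs t] and of [abs t = abs w] to the kernel
    [(ln (abs (t - w)) - ln (abs w)) / abs t ^+ 2]. The second one is written in
    terms of [abs w] and [t - w] only, so that it becomes radial after a
    translation; it vanishes off the sphere [abs t = abs w], because there
    [abs (t - w)] is the maximum of [abs t] and [abs w]. *)
Definition outer_kernel t w : R :=
  if eps <= abs t then log_gap (abs t) (abs w) / abs t ^+ 2 else 0.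

Definition inner_kernel t w : R :=
  if eps <= abs w then log_gap (abs w) (abs (t - w)) / abs w ^+ 2 else 0.

Lemma outer_kernel_ge0 t w : 0 <= outer_kernel t w.
Proof.
rewrite /outer_kernel; case: ifP => // _.
by rewrite divr_ge0 ?log_gap_ge0 ?exprn_ge0 ?(abs_ge0 habs).
Qed.

Lemma inner_kernel_ge0 t w : 0 <= inner_kernel t w.
Proof.
rewrite /inner_kernel; case: ifP => // _.
by rewrite divr_ge0 ?log_gap_ge0 ?exprn_ge0 ?(abs_ge0 habs).
Qed.

(** If [abs t < abs w] then [abs (t - w) = abs w] and all terms vanish; if
    [abs w < abs t] then [abs (t - w) = abs t] and only the outer part remains;
    if [abs t = abs w] then [abs (t - w) <= abs w] and only the inner part
    remains, with a sign. *)
Lemma kernel_decomposition t w : w != 0 -> t != w ->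
  (if eps <= abs t then (ln (abs (t - w)) - ln (abs w)) / abs t ^+ 2 else 0) =
  outer_kernel t w - inner_kernel t w.
Proof.
move=> w0 tw; have aw : 0 < abs w by rewrite (abs_gt0 habs).
have atw : 0 < abs (t - w) by rewrite (abs_gt0 habs) subr_eq0.
rewrite /outer_kernel /inner_kernel; case: (ltgtP (abs t) (abs w)) => h.
- have -> : abs (t - w) = abs w by rewrite (abs_distC habs) (abs_dominantB habs).
  by rewrite !log_gap_ge ?(ltW h)// subrr !mul0r !if_same subrr.
- rewrite (abs_dominantB habs h) (log_gap_le aw (ltW h)) log_gap_ge ?(ltW h)//.
  by rewrite mul0r if_same subr0.
- rewrite h log_gap_ge// log_gap_le//; last first.
    by apply: (abs_ultraB habs); rewrite ?h.
  by case: ifP => _; rewrite ?subr0// mul0r sub0r -mulNr opprB.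
Qed.

Lemma measurable_outer_kernel :
  measurable_fun setT (fun z : borel K * borel K => outer_kernel z.1 z.2).
Proof.
have m1 : measurable_fun setT (fun z : borel K * borel K => abs z.1).
  exact: measurableT_comp (measurable_abs habs) measurable_fst.
have m2 : measurable_fun setT (fun z : borel K * borel K => abs z.2).
  exact: measurableT_comp (measurable_abs habs) measurable_snd.
apply: measurable_fun_ifT => //; first exact: measurable_fun_ler.
apply: measurable_funM; first exact: measurable_log_gap.
apply: measurable_funV_ge0; last exact: measurable_funX.
by move=> z; rewrite exprn_ge0// (abs_ge0 habs).
Qed.

Lemma measurable_inner_kernel :
  measurable_fun setT (fun z : borel K * borel K => inner_kernel z.1 z.2).
Proof.
have m2 : measurable_fun setT (fun z : borel K * borel K => abs z.2).
  exact: measurableT_comp (measurable_abs habs) measurable_snd.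
apply: measurable_fun_ifT => //; first exact: measurable_fun_ler.
apply: measurable_funM.
  by apply: measurable_log_gap => //; exact: measurable_absB habs.
apply: measurable_funV_ge0; last exact: measurable_funX.
by move=> z; rewrite exprn_ge0// (abs_ge0 habs).
Qed.

Lemma measurable_section1 (F : borel K * borel K -> R) w :
  measurable_fun setT F -> measurable_fun setT (fun t : borel K => F (t, w)).
Proof. by move=> mF; exact: measurableT_comp mF (measurable_pair2 _). Qed.

Local Notation L := (ln q%:R / (q%:R - 1) : R).

Lemma sphere_series_closed_form (a b : R) :
  (1 - q%:R^-1) * (a / (1 - q%:R^-1) + b * q%:R^-1 / (1 - q%:R^-1) ^+ 2) =
  a + b / (q%:R - 1).
Proof.
have q1 := qR_gt1 habs; have q0 := qR_gt0 habs.
by field; rewrite subr_eq0 !gt_eqF.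
Qed.

(** The integrand is [n%:R * ln q%:R] on the sphere of radius
    [abs c / q%:R ^+ n]. *)
Lemma integral_log_gap c : c != 0 ->
  (\int[mu]_t (log_gap (abs c) (abs t))%:E = (abs c * L)%:E)%E.
Proof.
move=> c0; have [pi pi0 api] := uniformizer habs.
have ac0 : 0 < abs c by rewrite (abs_gt0 habs).
have q0 := qR_gt0 habs; have q1 := qR_gt1 habs.
have as_ n : abs (c * pi ^+ n) = abs c * q%:R^-1 ^+ n.
  by rewrite (absM habs) (absX habs) api.
rewrite (ge0_integral_spheres habs hmu (s := fun n => c * pi ^+ n) (a := 0)
  (b := abs c * ln q%:R) (x := q%:R^-1))
  ?sphere_series_closed_form ?invr_gt0 ?invf_lt1//.
- by rewrite add0r mulrA.
- by move=> n; rewrite mulf_neq0// expf_neq0.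
- exact: (spheres_inj habs c0 pi0 api).
- by apply: measurable_log_gap => //; exact: measurable_abs habs.
- by move=> t; exact: log_gap_ge0.
- move=> n t ->; rewrite as_ log_gap_le.
  + rewrite lnM ?posrE ?exprn_gt0 ?invr_gt0// lnXn ?invr_gt0// lnV ?posrE//.
    by rewrite mulNrn -mulr_natl; ring.
  + by rewrite mulr_gt0// exprn_gt0// invr_gt0.
  + by rewrite ger_pMr// exprn_ile1// ?invr_ge0 ?(ltW q0)// invf_le1// ltW.
- move=> t t0 h; apply: log_gap_ge; rewrite leNgt; apply/negP => tc.
  have [n hn] := abs_val habs t0 c0 (ltW tc).
  by apply: (h n); rewrite as_ hn exprVn.
Qed.

(** The integrand lives on the spheres of radius [abs c * q%:R ^+ n]: the cutoff
    [eps] and the condition [abs w < abs t] together bound [abs t] from below by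
    the larger of [eps] and [abs w], up to the sphere [abs t = abs w] on which
    the logarithm vanishes. *)
Lemma integral_outer_kernel w c : w != 0 -> c != 0 ->
  abs c = Num.max eps (abs w) ->
  (\int[mu]_t (outer_kernel t w)%:E =
    ((ln (abs c) - ln (abs w) + L) / abs c)%:E)%E.
Proof.
move=> w0 c0 cE; have [pi pi0 api] := uniformizer habs.
have ac0 : 0 < abs c by rewrite (abs_gt0 habs).
have aw0 : 0 < abs w by rewrite (abs_gt0 habs).
have wc : abs w <= abs c by rewrite cE le_max lexx orbT.
have ec : eps <= abs c by rewrite cE le_max lexx.
have q0 := qR_gt0 habs; have q1 := qR_gt1 habs.
have as_ n : abs (c * pi ^- n) = abs c * q%:R ^+ n.
  by rewrite (absM habs) (absV habs) (absX habs) api exprVn invrK.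
rewrite (ge0_integral_spheres habs hmu (s := fun n => c * pi ^- n)
  (a := (ln (abs c) - ln (abs w)) / abs c)
  (b := ln q%:R / abs c) (x := q%:R^-1))
  ?sphere_series_closed_form ?invr_gt0 ?invf_lt1//.
- congr EFin; field; rewrite subr_eq0 !gt_eqF//.
- by move=> n; rewrite mulf_neq0// invr_eq0 expf_neq0.
- move=> m n /=; rewrite !as_ => /(mulfI (lt0r_neq0 ac0)) h.
  by move: h; apply: ieexprIn; rewrite ?gt_eqF.
- exact: (measurable_section1 _ measurable_outer_kernel).
- by move=> t; exact: outer_kernel_ge0.
- move=> n t /=; rewrite as_ => ts.
  have tc : abs c <= abs t.
    by rewrite ts ler_peMr ?(ltW ac0)// exprn_ege1// ltW.
  rewrite /outer_kernel (le_trans ec tc) log_gap_le ?(le_trans wc)// ts.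
  rewrite lnM ?posrE ?exprn_gt0// lnXn// -mulr_natl exprVn; field.
  by rewrite mulr1 expf_neq0 ?gt_eqF.
- move=> t t0 h; rewrite /outer_kernel; case: ifPn => // et.
  rewrite log_gap_ge ?mul0r//; rewrite leNgt; apply/negP => wt.
  have ct : abs c <= abs t by rewrite cE ge_max et ltW.
  have [n hn] := abs_val habs c0 t0 ct.
  apply: (h n); rewrite as_ hn divfK// expf_neq0// gt_eqF//.
Qed.

(** Substituting [s = t - w] makes the integrand radial in [s]. *)
Lemma integral_inner_kernel w :
  (\int[mu]_t (inner_kernel t w)%:E =
    (if (eps <= abs w)%R then L / abs w else 0)%:E)%E.
Proof.
rewrite /inner_kernel; case: ifPn => ew; last by rewrite integral0.
have aw0 : 0 < abs w by rewrite (lt_le_trans eps0).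
have w0 : w != 0 by rewrite -(abs_gt0 habs).
pose g (s : borel K) : \bar R := (log_gap (abs w) (abs s) / abs w ^+ 2)%:E.
have mg : measurable_fun setT g.
  apply/measurable_EFinP; apply: measurable_funM => //.
  by apply: measurable_log_gap => //; exact: measurable_abs habs.
have g0 t : (0 <= g t)%E.
  by rewrite lee_fin divr_ge0 ?log_gap_ge0 ?exprn_ge0 ?(abs_ge0 habs).
transitivity (\int[mu]_t g (- w + 1 * (t : K))%R)%E.
  by apply: eq_integral => t _; rewrite mul1r addrC.
rewrite (ge0_integral_affine habs hmu) ?oner_eq0//.
rewrite (abs1 habs) invr1 mul1e /g.
under eq_integral do rewrite mulrC EFinM.
rewrite ge0_integralZl//.
- rewrite integral_log_gap// -EFinM; congr EFin; field.
  by rewrite subr_eq0 !gt_eqF// (qR_gt1 habs).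
- apply/measurable_EFinP; apply: measurable_log_gap => //.
  exact: measurable_abs habs.
- by move=> t _; rewrite lee_fin log_gap_ge0.
- by rewrite lee_fin invr_ge0 exprn_ge0// (abs_ge0 habs).
Qed.

End kernels.

(** * Locally bounded functions with power decay *)

Section decay.
Context {R : realType} {K : nonArchLocalFieldType} (abs : K -> R) (q : nat).
Hypothesis habs : normalized_abs abs q.
Variable mu : {measure set (borel K) -> \bar R}.
Hypothesis hmu : normalized_haar abs mu.
Variable beta : R.
Hypothesis beta1 : 1 < beta.
Implicit Types (x y c t w : K) (n : nat).

(** Replacing [abs t] by the maximum with 1 makes a single bound account for
    local boundedness and for decay at infinity, in a form that is stable under
    translations. *)
Definition decay_weight t : R := Num.max 1 (abs t) `^ (- beta).

Lemma decay_weight_ge0 t : 0 <= decay_weight t.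
Proof. exact: powR_ge0. Qed.

Lemma measurable_decay_weight : measurable_fun setT (decay_weight : borel K -> R).
Proof.
apply: (measurableT_comp (measurable_powR (- beta))).
by apply: measurable_maxr => //; exact: measurable_abs habs.
Qed.

Lemma measurable_ln_abs : measurable_fun setT (fun t : borel K => ln (abs t)).
Proof. exact: (measurableT_comp (@measurable_ln R) (measurable_abs habs)). Qed.

Lemma decay_weight_out n t : abs t = q%:R ^+ n ->
  decay_weight t * abs t = (q%:R `^ (1 - beta)) ^+ n.
Proof.
have q1 := qR_gt1 habs; have q0 := qR_gt0 habs.
move=> tn; rewrite /decay_weight tn (max_idPr _) ?exprn_ege1 ?(ltW q1)//.
have -> : 1 - beta = - beta + 1 by ring.
rewrite powRD; last by rewrite (gt_eqF q0) implybT.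
rewrite powRr1 ?(ltW q0)// exprMn; congr (_ * _).
rewrite -(powR_mulrn _ (ltW q0)) -(powR_mulrn _ (powR_ge0 _ _)).
by rewrite -!powRrM mulrC.
Qed.

(** The spheres inside the unit ball contribute a series of ratio [q%:R^-1], those
    outside one of ratio [q%:R `^ (1 - beta)], which is less than 1 because
    [1 < beta]. *)
Lemma integral_log_decay_lty :
  (\int[mu]_t ((1 + `|ln (abs t)|) * decay_weight t)%:E < +oo)%E.
Proof.
have [pi pi0 api] := uniformizer habs.
have q1 := qR_gt1 habs; have q0 := qR_gt0 habs; have lq := lnq_gt0 habs.
pose m t := (1 + `|ln (abs t)|) * decay_weight t.
have m0 t : 0 <= m t by rewrite mulr_ge0 ?decay_weight_ge0// addr_ge0.
have mm : measurable_fun setT (m : borel K -> R).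
  apply: measurable_funM measurable_decay_weight; apply: measurable_funD => //.
  exact: measurableT_comp measurable_ln_abs.
pose m1 t := if abs t <= 1 then m t else 0.
pose m2 t := if 1 <= abs t then m t else 0.
have mm1 : measurable_fun setT (m1 : borel K -> R).
  apply: measurable_fun_ifT => //; apply: measurable_fun_ler => //.
  exact: measurable_abs habs.
have mm2 : measurable_fun setT (m2 : borel K -> R).
  apply: measurable_fun_ifT => //; apply: measurable_fun_ler => //.
  exact: measurable_abs habs.
have m10 t : 0 <= m1 t by rewrite /m1; case: ifP.
have m20 t : 0 <= m2 t by rewrite /m2; case: ifP.
apply: (@le_lt_trans _ _ (\int[mu]_t ((m1 t)%:E + (m2 t)%:E))%E).
  apply: ge0_le_integral => //.
  - by move=> t _; rewrite lee_fin; exact: m0.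
  - exact/measurable_EFinP.
  - by apply: emeasurable_funD; exact/measurable_EFinP.
  - move=> t _; rewrite -EFinD lee_fin -/(m t) /m1 /m2.
    by case: (ltgtP (abs t) 1) => _; have := m0 t; lra.
rewrite ge0_integralD//; last 4 first.
- by move=> t _; rewrite lee_fin.
- exact/measurable_EFinP.
- by move=> t _; rewrite lee_fin.
- exact/measurable_EFinP.
have e1 n : abs (1 * pi ^+ n) = q%:R^-1 ^+ n.
  by rewrite mul1r (absX habs) api.
have e2 n : abs (1 * pi^-1 ^+ n) = q%:R ^+ n.
  by rewrite mul1r (absX habs) (absV habs) api invrK.
rewrite (ge0_integral_spheres habs hmu (g := m1) (s := fun n => 1 * pi ^+ n)
  (a := 1) (b := ln q%:R) (x := q%:R^-1)) ?invr_gt0 ?invf_lt1//; first last.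
- move=> t t0 h; rewrite /m1; case: ifPn => // t1; exfalso.
  have [n tn] := abs_le1_val habs t0 t1.
  by apply: (h n); rewrite e1 tn exprVn.
- move=> n t; rewrite e1 => tn.
  have t1 : abs t <= 1.
    by rewrite tn exprn_ile1 ?invr_ge0 ?(ltW q0)// invf_le1// ltW.
  rewrite /m1 t1 /m /decay_weight (max_idPl t1) powR1 mulr1 tn.
  rewrite lnXn ?invr_gt0// lnV ?posrE// mulNrn normrN.
  rewrite ger0_norm ?mulrn_wge0 ?(ltW lq)//.
  by rewrite -[ln _ *+ _]mulr_natr.
- exact: (spheres_inj habs (oner_neq0 _) pi0 api).
- by move=> n; rewrite mul1r expf_neq0.
rewrite (ge0_integral_spheres habs hmu (g := m2) (s := fun n => 1 * pi^-1 ^+ n)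
  (a := 1) (b := ln q%:R) (x := q%:R `^ (1 - beta))) ?powR_gt0//; first last.
- move=> t t0 h; rewrite /m2; case: ifPn => // t1; exfalso.
  have [|n] := abs_val habs (oner_neq0 K) t0; first by rewrite (abs1 habs).
  rewrite (abs1 habs) => tn; apply: (h n).
  have qn : q%:R ^+ n != 0 :> R by rewrite expf_neq0// gt_eqF.
  by rewrite e2 -[LHS](divfK qn) -tn mul1r.
- move=> n t; rewrite e2 => tn.
  have t1 : 1 <= abs t by rewrite tn exprn_ege1// ltW.
  rewrite /m2 t1 /m -mulrA (decay_weight_out tn) tn; congr (_ * _).
  by rewrite lnXn// ger0_norm ?mulrn_wge0 ?(ltW lq)// -[ln _ *+ _]mulr_natr.
- move=> i j /=; rewrite !e2; apply: ieexprIn; rewrite ?gt_eqF//.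
- by move=> n; rewrite mul1r expf_neq0// invr_eq0.
- by rewrite /powR gt_eqF// expR_lt1 pmulr_llt0 ?subr_lt0.
by rewrite -EFinD ltry.
Qed.

Definition decays (f : K -> R) : Prop :=
  measurable_fun setT (f : borel K -> R) /\
  exists2 C, 0 <= C &
    {ae mu, forall t : borel K, `|f t| <= C * decay_weight t}.

(** The multiplier may have a logarithmic singularity at 0 and logarithmic growth
    at infinity: this covers the Riesz kernel, the kernel [R], and the mass of
    the kernel of the truncated operator. *)
Lemma decays_integrable (f h : K -> R) (C : R) : decays f ->
  measurable_fun setT (h : borel K -> R) ->
  (forall t, t != 0 -> `|h t| <= C * (1 + `|ln (abs t)|)) ->
  mu.-integrable setT (fun t : borel K => (h t * f t)%:E).
Proof.
move=> [mf [D D0 fD]] mh hC.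
have C0 : 0 <= C.
  have := le_trans (normr_ge0 _) (hC 1 (oner_neq0 _)).
  by rewrite (abs1 habs) ln1 normr0 addr0 mulr1.
have mw : measurable_fun setT
    (fun t : borel K => ((1 + `|ln (abs t)|) * decay_weight t)%:E).
  apply/measurable_EFinP; apply: measurable_funM measurable_decay_weight.
  apply: measurable_funD => //; exact: measurableT_comp measurable_ln_abs.
have w0 t : (0 <= ((1 + `|ln (abs t)|) * decay_weight t)%:E)%E.
  by rewrite lee_fin mulr_ge0 ?decay_weight_ge0// addr_ge0.
apply/integrableP; split.
  by apply/measurable_EFinP; exact: measurable_funM.
apply: (@le_lt_trans _ _ (\int[mu]_t ((C * D)%:E *
    ((1 + `|ln (abs t)|) * decay_weight t)%:E))%E); last first.
  rewrite ge0_integralZl//; last by rewrite lee_fin mulr_ge0.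
  by rewrite lte_mul_pinfty ?lee_fin ?mulr_ge0// integral_log_decay_lty.
apply: ae_ge0_le_integral => //.
- apply: measurableT_comp => //; apply/measurable_EFinP; exact: measurable_funM.
- by move=> t _; rewrite mule_ge0// lee_fin mulr_ge0.
- exact: measurable_funeM.
have [N [mN muN hN]] := fD.
exists (N `|` [set (0 : K)]); split.
- apply: measurableU => //; exact: (measurable_point habs).
- rewrite -[RHS]muN; apply: measureU0 => //;
    [exact: (measurable_point habs)|exact: (mu_point habs hmu)].
move=> t /= ht; have [Nt|Nt] := pselect (N t); [by left|right].
apply: contrapT => /eqP t0; apply: ht => _.
rewrite -EFinM lee_fin normrM.
have ft : `|f t| <= D * decay_weight t.
  by apply: contrapT => nt; apply: Nt; exact: hN.
have -> : C * D * ((1 + `|ln (abs t)|) * decay_weight t) =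
   (C * (1 + `|ln (abs t)|)) * (D * decay_weight t) by ring.
by apply: ler_pM => //; exact: hC.
Qed.

(** Since [t = (x + t) - x], the maximum of 1 and [abs t] is at most the product
    of those for [x + t] and for [x]: a translation only affects the constant. *)
Lemma decays_shift (f : K -> R) x : decays f -> decays (fun t => f (x + t)).
Proof.
move=> [mf [D D0 fD]].
have mT := measurable_affine habs x 1.
have TE (t : K) : x + 1 * t = x + t by rewrite mul1r.
split.
  under eq_fun do rewrite -TE.
  exact: (measurableT_comp mf mT).
exists (D * Num.max 1 (abs x) `^ beta).
  by rewrite mulr_ge0// powR_ge0.
have [N [mN muN hN]] := fD.
exists ((fun t : borel K => (x + 1 * t : K)) @^-1` N); split.
- by rewrite -[X in measurable X]setTI; exact: mT.
- by rewrite (mu_preimage_affine habs hmu) ?oner_eq0// [X in (_ * X)%E]muN mule0.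
move=> t /= ht; apply: hN => /= h; apply: ht; rewrite TE in h.
apply: (le_trans h); rewrite -mulrA ler_wpM2l//.
have p0 z : 0 < Num.max 1 (abs z) by rewrite lt_max ltr01.
rewrite /decay_weight !powRN -[leRHS]invf_div.
rewrite lef_pV2 ?posrE ?divr_gt0 ?powR_gt0//.
have b0 : 0 <= beta by rewrite ltW// (lt_trans ltr01).
rewrite ler_pdivrMr; last by rewrite powR_gt0// lt_max ltr01.
have m0 z : 0 <= Num.max 1 (abs z) by rewrite le_max ler01.
rewrite -powRM//; apply: ge0_ler_powR => //; rewrite ?nnegrE ?mulr_ge0//.
rewrite ge_max; apply/andP; split.
  by rewrite -[leLHS]mulr1 ler_pM// le_max lexx.
have m1 z : 1 <= Num.max 1 (abs z) by rewrite le_max lexx.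
have ma z : abs z <= Num.max 1 (abs z) by rewrite le_max lexx orbT.
rewrite (_ : abs t = abs ((x + t) - x)); last by congr abs; ring.
apply: (abs_ultraB habs); apply: le_trans (ma _) _; first by rewrite ler_peMr.
by rewrite ler_peMl.
Qed.

End decay.

(** * Exchanging the integrals at the origin *)

Section core.
Context {R : realType} {K : nonArchLocalFieldType} (abs : K -> R) (q : nat).
Hypothesis habs : normalized_abs abs q.
Variable mu : {measure set (borel K) -> \bar R}.
Hypothesis hmu : normalized_haar abs mu.
Variables (beta eps : R) (sigma : K).
Hypotheses (beta1 : 1 < beta) (eps0 : 0 < eps) (hsigma : abs sigma = eps).
Implicit Types (x y c t w : K) (f : K -> R).
Local Notation L := (ln q%:R / (q%:R - 1) : R).

(** The two hypotheses are arguments so that sigma-finiteness, which depends on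
    them, can be attached to this measure as a canonical structure; product
    measures require it. *)
Definition haar_fun of normalized_abs abs q & normalized_haar abs mu :
  set (borel K) -> \bar R := mu.
HB.instance Definition _ := Measure.copy (haar_fun habs hmu) mu.
HB.instance Definition _ := Measure_isSigmaFinite.Build _ _ _
  (haar_fun habs hmu) (haar_sigma_finite habs hmu).
Definition haar_sfm : {sigma_finite_measure set (borel K) -> \bar R} :=
  haar_fun habs hmu.

Lemma sigma_neq0 : sigma != 0.
Proof. by rewrite -(abs_gt0 habs) hsigma. Qed.

Lemma L_gt0 : 0 < L.
Proof. by rewrite divr_gt0 ?(lnq_gt0 habs)// subr_gt0 (qR_gt1 habs). Qed.

Lemma kernelR_scaled w : w != 0 ->
  kernelR abs q (w / sigma) =
  if eps <= abs w then 0 else L + (ln eps - ln (abs w)).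
Proof.
move=> w0; have aw : 0 < abs w by rewrite (abs_gt0 habs).
rewrite /kernelR (absM habs) (absV habs) hsigma divr_gt0//=.
rewrite ltr_pdivrMr// mul1r ltNge; case: (boolP (eps <= abs w)) => //= _.
by rewrite ln_div ?posrE// opprB.
Qed.

Lemma integral_outer w : w != 0 ->
  (\int[mu]_t (outer_kernel abs eps t w)%:E =
   (if (eps <= abs w)%R then L / abs w else (ln eps - ln (abs w) + L) / eps)%:E)%E.
Proof.
move=> w0; case: leP => ew.
  rewrite (integral_outer_kernel habs hmu (c := w) w0 w0).
    by rewrite subrr add0r.
  by rewrite (max_idPr ew).
rewrite (integral_outer_kernel habs hmu (c := sigma) w0 sigma_neq0).
  by rewrite hsigma.
by rewrite hsigma (max_idPl (ltW ew)).
Qed.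

Lemma measurable_outer_section w :
  measurable_fun setT (fun t : borel K => outer_kernel abs eps t w).
Proof. exact: (measurable_section1 _ (measurable_outer_kernel habs eps)). Qed.

Lemma measurable_inner_section w :
  measurable_fun setT (fun t : borel K => inner_kernel abs eps t w).
Proof. exact: (measurable_section1 _ (measurable_inner_kernel habs eps)). Qed.

Lemma integrable_outer w : w != 0 ->
  mu.-integrable setT (fun t : borel K => (outer_kernel abs eps t w)%:E).
Proof.
move=> w0; apply/integrableP; split.
  by apply/measurable_EFinP; exact: measurable_outer_section.
under eq_integral do rewrite gee0_abs ?lee_fin ?(outer_kernel_ge0 habs)//.
by rewrite integral_outer// ltry.
Qed.

Lemma integrable_inner w :
  mu.-integrable setT (fun t : borel K => (inner_kernel abs eps t w)%:E).
Proof.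
apply/integrableP; split.
  by apply/measurable_EFinP; exact: measurable_inner_section.
under eq_integral do rewrite gee0_abs ?lee_fin ?(inner_kernel_ge0 habs)//.
by rewrite (integral_inner_kernel habs hmu eps0) ltry.
Qed.

(** For [eps <= abs w] the outer and inner integrals are both [L / abs w] and
    cancel; this is why [R] is supported in the unit ball. For [abs w < eps] the
    inner one vanishes. *)
Lemma integral_kernel_difference w : w != 0 ->
  (\int[mu]_t (outer_kernel abs eps t w - inner_kernel abs eps t w)%:E =
   (eps^-1 * kernelR abs q (w / sigma))%:E)%E.
Proof.
move=> w0; have aw : 0 < abs w by rewrite (abs_gt0 habs).
under eq_integral do rewrite EFinB.
rewrite integralB_EFin//; [|exact: integrable_outer|exact: integrable_inner].
rewrite [X in (X - _)%E]integral_outer//.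
rewrite [X in (_ - X)%E](integral_inner_kernel habs hmu eps0).
rewrite -EFinB (kernelR_scaled w0); congr EFin; case: ifPn => _.
  by rewrite subrr mulr0.
by rewrite subr0 mulrC addrC.
Qed.

(** Owing to the conventions at [w = 0], the identities for the integral in [t]
    hold for every [w], and not only for almost every [w]. *)
Lemma kernel_at0 t : outer_kernel abs eps t 0 - inner_kernel abs eps t 0 = 0.
Proof.
rewrite /outer_kernel /inner_kernel /log_gap (abs0 habs) ltxx/= mul0r if_same.
by rewrite leNgt eps0 subrr.
Qed.

(* Large enough for both regimes of [integral_kernel_sum]: the mass is
   2 L / |w| if |w| >= eps, and (ln eps - ln |w| + L) / eps otherwise. *)
Let C : R := (2 * L + `|ln eps| + 1) / eps.

Let C_ge0 : 0 <= C.
Proof.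
have := ltW L_gt0 => L0.
by rewrite divr_ge0 ?(ltW eps0)// addr_ge0// addr_ge0// mulr_ge0.
Qed.

(** This bound on the absolute mass of the kernel, logarithmic in [abs w], is what
    justifies Fubini's theorem. *)
Lemma integral_kernel_sum w : w != 0 ->
  (\int[mu]_t (outer_kernel abs eps t w + inner_kernel abs eps t w)%:E <=
   (C * (1 + `|ln (abs w)|))%:E)%E.
Proof.
move=> w0; have aw : 0 < abs w by rewrite (abs_gt0 habs).
have L0 := L_gt0.
under eq_integral do rewrite EFinD.
rewrite integralD_EFin//; [|exact: integrable_outer|exact: integrable_inner].
rewrite [X in (X + _)%E]integral_outer//.
rewrite [X in (_ + X)%E](integral_inner_kernel habs hmu eps0).
rewrite -EFinD lee_fin /C [X in _ <= X]mulrAC ler_pdivlMr//.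
have n1 := normr_ge0 (ln (abs w)); have n2 := normr_ge0 (ln eps).
case: (leP eps (abs w)) => ew.
  apply: (@le_trans _ _ (2 * L)); last by nra.
  have h : L / abs w * eps <= L by rewrite mulrAC ler_pdivrMr// ler_pM2l.
  by rewrite mulrDl; lra.
rewrite addr0 divfK ?gt_eqF//.
have := ler_norm (ln eps); have := ler_norm (- ln (abs w)); rewrite normrN; nra.
Qed.

Definition double_integrand f (z : borel K * borel K) : R :=
  (outer_kernel abs eps z.1 z.2 - inner_kernel abs eps z.1 z.2) * f z.2.

Lemma measurable_double_integrand f :
  measurable_fun setT (f : borel K -> R) ->
  measurable_fun setT (double_integrand f).
Proof.
move=> mf; apply: measurable_funM.
  apply: measurable_funB; first exact: (measurable_outer_kernel habs).
  exact: (measurable_inner_kernel habs).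
exact: (measurableT_comp mf measurable_snd).
Qed.

(** After the substitution [s = w - t] the logarithm is centred at 0 and the
    density is a translate of [f]. *)
Lemma integrable_log_convolution f t : decays abs mu beta f ->
  mu.-integrable setT (fun w : borel K => (ln (abs (t - w)) * f w)%:E).
Proof.
move=> df.
have := decays_integrable habs hmu beta1 (h := fun s => ln (abs s)) (C := 1)
  (decays_shift habs hmu beta1 t df) (measurable_ln_abs habs).
move=> /(_ _)/wrap[s _|]; first by rewrite mul1r lerDr.
move=> /(integrable_affine habs hmu (- t) (oner_neq0 K)).
apply: eq_integrable => // w _; congr EFin; rewrite mul1r addNKr.
by rewrite addrC (abs_distC habs).
Qed.

Lemma double_integrand_integrable f : decays abs mu beta f ->
  (haar_sfm \x haar_sfm)%E.-integrable setT (EFin \o double_integrand f).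
Proof.
move=> df; have [mf _] := df.
have mF : measurable_fun setT (EFin \o double_integrand f).
  by apply/measurable_EFinP; exact: measurable_double_integrand.
apply/integrable21ltyP => //.
pose h w := C * (1 + `|ln (abs w)|).
have mh : measurable_fun setT (h : borel K -> R).
  apply: measurable_funM => //; apply: measurable_funD => //.
  by apply: measurableT_comp => //; exact: measurable_ln_abs habs.
have h0 w : 0 <= h w by rewrite mulr_ge0// addr_ge0.
have /integrableP[_] := decays_integrable habs hmu beta1 (h := h) (C := C) df mh
  (fun w _ => ltac:(by rewrite ger0_norm)).
apply: le_lt_trans.
apply: ge0_le_integral => //.
- by move=> w _; apply: integral_ge0.
- apply: (measurable_fun_fubini_tonelli_G
    (abse \o (EFin \o double_integrand f))) => //=.
  exact: measurableT_comp.
- apply: measurableT_comp => //; apply/measurable_EFinP; exact: measurable_funM.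
move=> w _; have [->|w0] := eqVneq w (0 : K).
  rewrite integral0_eq ?abse_ge0// => t _.
  by rewrite /double_integrand /= kernel_at0 mul0r normr0.
have k0 t : 0 <= outer_kernel abs eps t w + inner_kernel abs eps t w.
  by rewrite addr_ge0 ?(outer_kernel_ge0 habs) ?(inner_kernel_ge0 habs).
have mk : measurable_fun setT (fun t : borel K =>
    outer_kernel abs eps t w + inner_kernel abs eps t w).
  exact: measurable_funD (measurable_outer_section w) (measurable_inner_section w).
apply: (@le_trans _ _ (\int[mu]_t ((`|f w|)%:E *
   (outer_kernel abs eps t w + inner_kernel abs eps t w)%:E))%E).
  apply: ge0_le_integral => //.
  - apply: measurableT_comp => //.
    apply/measurable_EFinP.
    exact: (measurable_section1 w (measurable_double_integrand mf)).
  - by apply: measurable_funeM; apply/measurable_EFinP.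
  - move=> t _; rewrite /double_integrand /= -EFinM lee_fin normrM mulrC.
    rewrite ler_wpM2l// (le_trans (ler_normB _ _))//.
    by rewrite !ger0_norm ?(outer_kernel_ge0 habs) ?(inner_kernel_ge0 habs).
rewrite ge0_integralZl//; last 2 first.
- exact/measurable_EFinP.
- by move=> t _; rewrite lee_fin.
rewrite /= normrM (ger0_norm (h0 w)) mulrC EFinM.
by apply: lee_wpmul2l; [rewrite lee_fin|exact: integral_kernel_sum].
Qed.

Lemma integral_double_integrand_l f w :
  (\int[mu]_t (double_integrand f (t, w))%:E =
   (eps^-1 * (kernelR abs q (w / sigma) * f w))%:E)%E.
Proof.
have [->|w0] := eqVneq w (0 : K).
  rewrite integral0_eq; last first.
    by move=> t _; rewrite /double_integrand /= kernel_at0 mul0r.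
  by rewrite mul0r /kernelR (abs0 habs) ltxx mul0r mulr0.
under eq_integral do rewrite /double_integrand /= EFinM.
rewrite integralZr//; last first.
  under eq_fun do rewrite EFinB.
  by apply: integrableB => //; [exact: integrable_outer|exact: integrable_inner].
by rewrite integral_kernel_difference// -EFinM mulrA.
Qed.

Definition log_convolution f t : R :=
  Rintegral mu setT (fun w : borel K => ln (abs (t - w)) * f w).

Definition truncated_quotient f t : R :=
  if eps <= abs t
  then (log_convolution f t - log_convolution f 0) / abs t ^+ 2 else 0.

Lemma EFin_Rintegral (g : borel K -> R) : mu.-integrable setT (EFin \o g) ->
  (Rintegral mu setT g)%:E = (\int[mu]_w (g w)%:E)%E.
Proof. by move=> gi; rewrite fineK//; exact: integrable_fin_num. Qed.

(** The decomposition of the kernel fails only at [w = 0] and at [w = t], which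
    form a null set. *)
Lemma integral_double_integrand_r f t : decays abs mu beta f ->
  (\int[mu]_w (double_integrand f (t, w))%:E = (truncated_quotient f t)%:E)%E.
Proof.
move=> df; have [mf _] := df.
have i0 := integrable_log_convolution 0 df.
have it := integrable_log_convolution t df.
pose g w := (if eps <= abs t
  then (ln (abs (t - w)) * f w - ln (abs (0 - w)) * f w) / abs t ^+ 2 else 0).
have mg : measurable_fun setT (g : borel K -> R).
  rewrite /g; case: (eps <= abs t) => //; apply: measurable_funM => //.
  by apply: measurable_funB; [apply/measurable_EFinP; exact: measurable_int it|
    apply/measurable_EFinP; exact: measurable_int i0].
transitivity (\int[mu]_w (g w)%:E)%E.
  apply: ae_eq_integral => //.
  - apply/measurable_EFinP.
    exact: (measurableT_comp (measurable_double_integrand mf)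
      (@measurable_pair1 _ _ (borel K) (borel K) t)).
  - exact/measurable_EFinP.
  exists ([set (0 : K)] `|` [set t]); split.
  - by apply: measurableU; exact: (measurable_point habs).
  - rewrite -[RHS](mu_point habs hmu 0); apply: measureU0 => //;
      [exact: (measurable_point habs)|exact: (measurable_point habs)|
       exact: (mu_point habs hmu)].
  move=> w /= h; have [->|w0] := eqVneq w (0 : K); first by left.
  right; apply: contrapT => /eqP wt; apply: h => _.
  rewrite eq_sym in wt.
  rewrite /double_integrand /= -(kernel_decomposition habs eps w0 wt) /g.
  by rewrite sub0r (absN habs); case: ifP => _; [congr EFin; ring|rewrite mul0r].
rewrite /truncated_quotient /g; case: (eps <= abs t); last by rewrite integral0.
under eq_integral do rewrite EFinM EFinB.
rewrite integralZr//; last exact: integrableB.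
rewrite integralB_EFin// EFinM EFinB; congr ((_ - _) * _)%E.
- by rewrite EFin_Rintegral.
- by rewrite EFin_Rintegral.
Qed.

Lemma truncated_quotient_integrable f : decays abs mu beta f ->
  mu.-integrable setT (fun t : borel K => (truncated_quotient f t)%:E).
Proof.
move=> df; have := integrable_fubini_F (double_integrand_integrable df).
apply: eq_integrable => // t _; exact: integral_double_integrand_r.
Qed.

Lemma measurable_kernelR :
  measurable_fun setT (kernelR abs q : borel K -> R).
Proof.
apply: measurable_fun_ifT => //.
  apply: measurable_and; apply: measurable_fun_ltr => //;
    exact: measurable_abs habs.
by apply: measurable_funB => //; exact: measurable_ln_abs habs.
Qed.

Lemma kernel_integrable f : decays abs mu beta f ->
  mu.-integrable setT (fun w : borel K => (kernelR abs q (w / sigma) * f w)%:E).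
Proof.
move=> df; have L0 := L_gt0.
apply: (decays_integrable habs hmu beta1 (h := fun w => kernelR abs q (w / sigma))
  (C := L + `|ln eps| + 1) df).
- have -> : (fun w : borel K => kernelR abs q ((w : K) / sigma)) =
     (fun w : borel K => kernelR abs q (0 + sigma^-1 * (w : K))).
    by apply/funext => w; rewrite add0r mulrC.
  exact: (measurableT_comp measurable_kernelR (measurable_affine habs 0 sigma^-1)).
- move=> w w0; rewrite kernelR_scaled//.
  have n1 := normr_ge0 (ln (abs w)); have n2 := normr_ge0 (ln eps).
  case: (leP eps (abs w)) => _; first by rewrite normr0; nra.
  have := ler_normD L (ln eps - ln (abs w)); rewrite (gtr0_norm L0).
  have := ler_normB (ln eps) (ln (abs w)); nra.
Qed.

(** Fubini: integrating in [w] first gives the truncated quotient, integrating in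
    [t] first gives the kernel [R]. *)
Lemma integral_truncated_quotient f : decays abs mu beta f ->
  (\int[mu]_t (truncated_quotient f t)%:E =
   (eps^-1)%:E * \int[mu]_w (kernelR abs q (w / sigma) * f w)%:E)%E.
Proof.
move=> df.
rewrite -integralZl//; last exact: kernel_integrable.
transitivity (\int[mu]_t \int[mu]_w (double_integrand f (t, w))%:E)%E.
  by apply: eq_integral => t _; rewrite integral_double_integrand_r.
transitivity (\int[mu]_w \int[mu]_t (double_integrand f (t, w))%:E)%E.
  exact: (Fubini (double_integrand_integrable df)).
by apply: eq_integral => w _; rewrite integral_double_integrand_l EFinM.
Qed.

End core.

(** * Translation to an arbitrary point *)

Section shifted.
Context {R : realType} {K : nonArchLocalFieldType} (abs : K -> R) (q : nat).
Hypothesis habs : normalized_abs abs q.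
Variable mu : {measure set (borel K) -> \bar R}.
Hypothesis hmu : normalized_haar abs mu.
Variables (beta eps : R) (sigma : K).
Hypotheses (beta1 : 1 < beta) (eps0 : 0 < eps) (hsigma : abs sigma = eps).
Implicit Types (x y c t w tau : K) (f : K -> R).
Local Notation U := (log_convolution abs mu).

Lemma log_convolution_shift f x t : decays abs mu beta f ->
  U (fun w => f (x + w)) t = U f (x + t).
Proof.
move=> df; rewrite /log_convolution /Rintegral; congr fine.
have := integral_affine habs hmu x (oner_neq0 K)
  (integrable_log_convolution habs hmu beta1 (x + t) df).
rewrite (abs1 habs) invr1 mul1e => <-.
apply: eq_integral => w _; rewrite mul1r; congr (ln (abs _) * _)%:E; ring.
Qed.

Lemma truncated_quotient_shift f x y : decays abs mu beta f ->
  truncated_quotient abs mu eps (fun w => f (x + w)) (- x + 1 * y) =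
  if eps <= abs (y - x) then (U f y - U f x) / abs (y - x) ^+ 2 else 0.
Proof.
move=> df; rewrite /truncated_quotient mul1r !log_convolution_shift//.
by rewrite addNKr addr0 [- x + y]addrC.
Qed.

Let restrict_trunc f x (y : borel K) :
  ((fun y : borel K => ((U f y - U f x) / abs ((y : K) - x) ^+ 2)%:E)
     \_ (trunc_domain abs eps x)) y =
  (if eps <= abs ((y : K) - x) then (U f y - U f x) / abs ((y : K) - x) ^+ 2
   else 0)%:E.
Proof.
rewrite /patch /trunc_domain; case: ifPn => [|/negP]; rewrite inE /= => h.
  by rewrite h.
by move/negP: h => /negbTE ->.
Qed.

Lemma measurable_trunc_domain x : measurable (trunc_domain abs eps x).
Proof.
rewrite (_ : trunc_domain _ _ _ = ~` [set y : K | abs (y - x) < eps]).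
  by apply: measurableC; apply: open_measurable_borel; exact: (open_abs_lt habs).
by apply/seteqP; split=> y; rewrite /trunc_domain /= leNgt => /negP.
Qed.

Lemma integrable_trunc f x : decays abs mu beta f ->
  mu.-integrable (trunc_domain abs eps x)
    (fun y : borel K => ((U f y - U f x) / abs ((y : K) - x) ^+ 2)%:E).
Proof.
move=> df; apply/integrable_mkcond; first exact: measurable_trunc_domain.
have := truncated_quotient_integrable habs hmu beta1 eps0 hsigma
  (decays_shift habs hmu beta1 x df).
move=> /(integrable_affine habs hmu (- x) (oner_neq0 K)).
apply: eq_integrable => // y _.
by rewrite restrict_trunc truncated_quotient_shift.
Qed.

Lemma kernelRN tau : kernelR abs q (- tau) = kernelR abs q tau.
Proof. by rewrite /kernelR (absN habs). Qed.

Let kernel_substE f x tau :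
  (kernelR abs q ((0 + - sigma * tau) / sigma) * f (x + (0 + - sigma * tau)))%:E =
  (kernelR abs q tau * f (x - sigma * tau))%:E.
Proof.
rewrite add0r mulNr mulNr kernelRN mulrAC mulfV ?mul1r//.
exact: (sigma_neq0 habs eps0 hsigma).
Qed.

Lemma integrable_kernel_subst f x : decays abs mu beta f ->
  mu.-integrable setT
    (fun tau : borel K => (kernelR abs q tau * f (x - sigma * tau))%:E).
Proof.
move=> df.
have s0 : - sigma != 0 by rewrite oppr_eq0 (sigma_neq0 habs eps0 hsigma).
have := kernel_integrable habs hmu beta1 eps0 hsigma
  (decays_shift habs hmu beta1 x df).
move=> /(integrable_affine habs hmu 0 s0).
by apply: eq_integrable => // tau _; exact: kernel_substE.
Qed.

Lemma Rintegral_trunc f x : decays abs mu beta f ->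
  Rintegral mu (trunc_domain abs eps x)
    (fun y : borel K => (U f y - U f x) / abs ((y : K) - x) ^+ 2) =
  Rintegral mu setT
    (fun tau : borel K => kernelR abs q tau * f (x - sigma * tau)).
Proof.
move=> df; have dfx := decays_shift habs hmu beta1 x df.
have s0 : - sigma != 0 by rewrite oppr_eq0 (sigma_neq0 habs eps0 hsigma).
rewrite /Rintegral; congr fine; rewrite integral_mkcond.
have := integral_affine habs hmu (- x) (oner_neq0 K)
  (truncated_quotient_integrable habs hmu beta1 eps0 hsigma dfx).
rewrite (abs1 habs) invr1 mul1e.
rewrite (integral_truncated_quotient habs hmu beta1 eps0 hsigma dfx).
have := integral_affine habs hmu 0 s0
  (kernel_integrable habs hmu beta1 eps0 hsigma dfx).
rewrite (absN habs) hsigma => <- h.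
transitivity (\int[mu]_y (truncated_quotient abs mu eps (fun w => f (x + w))
   (- x + 1 * (y : K)))%:E)%E.
  by apply: eq_integral => y _; rewrite restrict_trunc truncated_quotient_shift.
by rewrite h; apply: eq_integral => tau _; exact: kernel_substE.
Qed.

End shifted.

(** * Positivity and total mass of the kernel *)

Section kernel_R1.
Context {R : realType} {K : nonArchLocalFieldType} (abs : K -> R) (q : nat).
Hypothesis habs : normalized_abs abs q.
Variable mu : {measure set (borel K) -> \bar R}.
Hypothesis hmu : normalized_haar abs mu.

Lemma c1d1E : c1 q * d1 q = q%:R * (q%:R - 1) / ((q%:R + 1) * ln q%:R) :> R.
Proof.
have q1 := qR_gt1 habs; have q0 := qR_gt0 habs; have l0 := lnq_gt0 habs.
have q2 : 0 < q%:R ^+ 2 - 1 :> R by nra.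
by rewrite /c1 /d1; field; rewrite !gt_eqF// addr_gt0.
Qed.

Lemma kernelR1_gt0 (tau : K) : 0 < abs tau < 1 -> 0 < kernelR1 abs q tau.
Proof.
move=> h; rewrite /kernelR1 c1d1E mulr_gt0//.
  have q1 := qR_gt1 habs; have q0 := qR_gt0 habs.
  by apply: divr_gt0; apply: mulr_gt0; rewrite ?subr_gt0 ?addr_gt0 ?(lnq_gt0 habs).
rewrite /kernelR h; case/andP: h => t0 t1.
rewrite subr_gt0 (@lt_trans _ _ 0)//.
  by rewrite ln_lt0 ?t0.
by rewrite divr_gt0 ?(lnq_gt0 habs)// subr_gt0 (qR_gt1 habs).
Qed.

(** With [L = ln q%:R / (q%:R - 1)], the constant part of [R] contributes
    [L / q%:R] and the logarithm contributes [L]; the factor [c1 q * d1 q] is the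
    inverse of their sum. *)
Lemma integral_kernelR1 : (\int[mu]_tau (kernelR1 abs q tau)%:E = 1)%E.
Proof.
have [pi pi0 api] := uniformizer habs.
have q1 := qR_gt1 habs; have q0 := qR_gt0 habs; have l0 := lnq_gt0 habs.
have as_ n : abs (pi * pi ^+ n) = q%:R^-1 ^+ n.+1.
  by rewrite -exprS (absX habs) api.
rewrite (ge0_integral_spheres habs hmu (s := fun n => pi * pi ^+ n)
  (a := c1 q * d1 q * (ln q%:R / (q%:R - 1) + ln q%:R) / q%:R)
  (b := c1 q * d1 q * ln q%:R / q%:R) (x := q%:R^-1))
  ?(sphere_series_closed_form habs) ?invr_gt0 ?invf_lt1//.
- rewrite c1d1E; congr EFin; field.
  by rewrite !gt_eqF ?subr_gt0 ?addr_gt0.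
- by move=> n; rewrite mulf_neq0// expf_neq0.
- exact: (spheres_inj habs pi0 pi0 api).
- by apply: measurable_funM => //; exact: (measurable_kernelR habs).
- move=> tau; have [/kernelR1_gt0/ltW//|] := boolP (0 < abs tau < 1).
  by rewrite /kernelR1 /kernelR => /negbTE ->; rewrite mulr0.
- move=> n tau; rewrite as_ => tn.
  have t01 : 0 < abs tau < 1.
    by rewrite tn exprn_gt0 ?invr_gt0//= exprn_ilt1 ?invr_ge0 ?(ltW q0)// invf_lt1.
  rewrite /kernelR1 /kernelR t01 tn lnXn ?invr_gt0// lnV ?posrE//.
  rewrite -[_ *+ n.+1]mulr_natl exprS.
  rewrite -[n.+1%:R]natr1; field.
  by rewrite !gt_eqF ?subr_gt0.
- move=> tau tau0 h; rewrite /kernelR1 /kernelR; case: ifPn => [/andP[_ t1]|_];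
    last by rewrite mulr0.
  exfalso; have [|n hn] := abs_val habs tau0 pi0.
    by rewrite api; exact: (abs_gap1 habs).
  by apply: (h n); rewrite as_ hn api exprS exprVn.
Qed.

End kernel_R1.

(** * Complex-valued densities *)

Section complex_valued.
Context {R : realType} {K : nonArchLocalFieldType} (abs : K -> R) (q : nat).
Hypothesis habs : normalized_abs abs q.
Variable mu : {measure set (borel K) -> \bar R}.
Hypothesis hmu : normalized_haar abs mu.

Lemma Re_realM (a : R) (z : R[i]) : complex.Re (a%:C * z) = a * complex.Re z.
Proof. by case: z => x y /=; rewrite mul0r subr0. Qed.

Lemma Im_realM (a : R) (z : R[i]) : complex.Im (a%:C * z) = a * complex.Im z.
Proof. by case: z => x y /=; rewrite mul0r addr0. Qed.

Lemma Re_sub (z w : R[i]) : complex.Re (z - w) = complex.Re z - complex.Re w.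
Proof. by case: z w => [a b] []. Qed.

Lemma Im_sub (z w : R[i]) : complex.Im (z - w) = complex.Im z - complex.Im w.
Proof. by case: z w => [a b] []. Qed.

Lemma Re_le_normc (z : R[i]) : `|complex.Re z| <= Normc.normc z.
Proof.
by case: z => a b /=; rewrite -sqrtr_sqr ler_wsqrtr// lerDl sqr_ge0.
Qed.

Lemma Im_le_normc (z : R[i]) : `|complex.Im z| <= Normc.normc z.
Proof.
by case: z => a b /=; rewrite -sqrtr_sqr ler_wsqrtr// lerDr sqr_ge0.
Qed.

(** Off a large ball the bound at infinity applies as it stands. The ball itself is
    compact, so the density is essentially bounded there, and the factor
    [(q%:R ^+ n) `^ beta] compensates for the weight, which is at least
    [(q%:R ^+ n) `^ (- beta)] on it. *)
Lemma decays_dominated (beta : R) (phi : K -> R[i]) (f : K -> R) :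
  1 < beta -> Linfty_loc mu phi -> bigO_at_infty abs beta phi ->
  measurable_fun setT (f : borel K -> R) ->
  (forall t, `|f t| <= Normc.normc (phi t)) -> decays abs mu beta f.
Proof.
move=> beta1 [_ hloc] [C [M hO]] mf fphi; split=> //.
have b0 : 0 <= beta by rewrite ltW// (lt_trans ltr01).
have [pi pi0 api] := uniformizer habs.
have q1 := qR_gt1 habs; have q0 := qR_gt0 habs.
have [n hn] : exists n, M <= q%:R ^+ n.
  have [n hn] : exists n, q%:R ^- n < (1 + `|M|)^-1.
    by apply: (expqV_lt habs); rewrite invr_gt0 ltr_wpDr.
  exists n; move: hn; rewrite ltf_pV2 ?posrE ?exprn_gt0 ?ltr_wpDr// => hn.
  by have := ler_norm M; lra.
have en : abs (pi ^- n) = q%:R ^+ n.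
  by rewrite (absV habs) (absX habs) api exprVn invrK.
have pn0 : pi ^- n != 0 by rewrite invr_eq0 expf_neq0.
have [B hB] := hloc _ (compact_cball habs (x := 0) pn0).
exists (`|B| * (q%:R ^+ n) `^ beta + `|C|).
  by rewrite addr_ge0// mulr_ge0// powR_ge0.
apply: filterS hB => t hB.
apply: (le_trans (fphi t)); have w0 := decay_weight_ge0 abs beta t.
have qn1 : 1 <= q%:R ^+ n :> R by rewrite exprn_ege1// ltW.
have [tn|tn] := leP (abs t) (q%:R ^+ n).
- have h : Normc.normc (phi t) <= B by apply: hB; rewrite /cball /= subr0 en.
  rewrite mulrDl ler_wpDr ?mulr_ge0//.
  apply: (le_trans h); apply: (le_trans (ler_norm B)).
  rewrite -mulrA ler_peMr// /decay_weight powRN ler_pdivlMr ?mul1r; last first.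
    by rewrite powR_gt0// lt_max ltr01.
  apply: ge0_ler_powR; rewrite ?nnegrE ?le_max ?ler01 ?exprn_ge0 ?(ltW q0)//.
  by rewrite ge_max qn1 tn.
- have := hO t (le_lt_trans hn tn) => /le_trans; apply.
  have -> : decay_weight abs beta t = abs t `^ (- beta).
    by rewrite /decay_weight (max_idPr _)// ltW// (le_lt_trans qn1).
  rewrite mulrDl ler_wpDl ?ler_wpM2r ?powR_ge0 ?ler_norm//.
  by rewrite !mulr_ge0 ?powR_ge0.
Qed.

End complex_valued.

Theorem proposition2 (R : realType) (K : nonArchLocalFieldType)
    (abs : K -> R) (q : nat) (mu : {measure set (borel K) -> \bar R})
    (habs : normalized_abs abs q) (hmu : normalized_haar abs mu)
    (phi : K -> R[i]) (beta : R) (nu : nat) (eps : R) (sigma : K)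
    (hphi_loc : Linfty_loc mu phi)
    (hbeta : 1 < beta) (hphi_infty : bigO_at_infty abs beta phi)
    (heps : eps = q%:R ^- nu) (hsigma : abs sigma = eps) :
  let u := log_riesz abs q mu phi in
  [/\ forall x : K,
        [/\ cintegrable mu setT (riesz_integrand abs phi x),
            cintegrable mu (trunc_domain abs eps x) (trunc_integrand abs u x),
            cintegrable mu setT (kernel_integrand abs q phi sigma x) &
            trunc_diff abs q mu eps u x =
              (c1 q * d1 q)%:C *
                cintegral mu setT (kernel_integrand abs q phi sigma x)],
      forall tau : K, 0 < abs tau < 1 -> 0 < kernelR1 abs q tau &
      (\int[mu]_tau (kernelR1 abs q tau)%:E = 1)%E].
Proof.
move=> u; split; [|exact: kernelR1_gt0|exact: integral_kernelR1].
have eps0 : 0 < eps by rewrite heps invr_gt0 exprn_gt0// (qR_gt0 habs).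
have [[mre mim] _] := hphi_loc.
pose fr (t : K) := complex.Re (phi t); pose fi (t : K) := complex.Im (phi t).
have dr : decays abs mu beta fr.
  apply: (decays_dominated habs hbeta hphi_loc hphi_infty mre) => t.
  exact: Re_le_normc.
have di : decays abs mu beta fi.
  apply: (decays_dominated habs hbeta hphi_loc hphi_infty mim) => t.
  exact: Im_le_normc.
have uRe y : complex.Re (u y) = d1 q * log_convolution abs mu fr y.
  rewrite /u /log_riesz Re_realM /=; congr (_ * fine _).
  by apply: eq_integral => w _; rewrite /riesz_integrand Re_realM.
have uIm y : complex.Im (u y) = d1 q * log_convolution abs mu fi y.
  rewrite /u /log_riesz Im_realM /=; congr (_ * fine _).
  by apply: eq_integral => w _; rewrite /riesz_integrand Im_realM.
pose Q f x (y : borel K) : R := (log_convolution abs mu f y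
  - log_convolution abs mu f x) / abs ((y : K) - x) ^+ 2.
have tRe x y : complex.Re (trunc_integrand abs u x y) = d1 q * Q fr x y.
  rewrite /trunc_integrand -fmorphV mulrC Re_realM Re_sub !uRe /Q; ring.
have tIm x y : complex.Im (trunc_integrand abs u x y) = d1 q * Q fi x y.
  rewrite /trunc_integrand -fmorphV mulrC Im_realM Im_sub !uIm /Q; ring.
have iQ f x : decays abs mu beta f ->
    mu.-integrable (trunc_domain abs eps x) (EFin \o Q f x).
  exact: (integrable_trunc habs hmu hbeta eps0 hsigma).
have mD x := measurable_trunc_domain habs eps x.
move=> x; split.
- split.
    under eq_fun do rewrite /riesz_integrand Re_realM.
    exact: (integrable_log_convolution habs hmu hbeta x dr).
  under eq_fun do rewrite /riesz_integrand Im_realM.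
  exact: (integrable_log_convolution habs hmu hbeta x di).
- split.
    under eq_fun do rewrite tRe EFinM.
    by apply: integrableZl => //; exact: iQ.
  under eq_fun do rewrite tIm EFinM.
  by apply: integrableZl => //; exact: iQ.
- split.
    under eq_fun do rewrite /kernel_integrand Re_realM.
    exact: (integrable_kernel_subst habs hmu hbeta eps0 hsigma x dr).
  under eq_fun do rewrite /kernel_integrand Im_realM.
  exact: (integrable_kernel_subst habs hmu hbeta eps0 hsigma x di).
have cT : cintegral mu (trunc_domain abs eps x) (trunc_integrand abs u x) =
    (d1 q)%:C * cintegral mu setT (kernel_integrand abs q phi sigma x).
  apply/eqP; rewrite eq_complex Re_realM Im_realM /=; apply/andP; split; apply/eqP.
    transitivity (Rintegral mu (trunc_domain abs eps x) (fun y => d1 q * Q fr x y)).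
      by apply: eq_Rintegral => y _; exact: tRe.
    rewrite RintegralZl//; last exact: iQ.
    rewrite (Rintegral_trunc habs hmu hbeta eps0 hsigma x dr); congr (_ * _).
    by apply: eq_Rintegral => y _; rewrite /kernel_integrand Re_realM.
  transitivity (Rintegral mu (trunc_domain abs eps x) (fun y => d1 q * Q fi x y)).
    by apply: eq_Rintegral => y _; exact: tIm.
  rewrite RintegralZl//; last exact: iQ.
  rewrite (Rintegral_trunc habs hmu hbeta eps0 hsigma x di); congr (_ * _).
  by apply: eq_Rintegral => y _; rewrite /kernel_integrand Im_realM.
by rewrite /trunc_diff cT mulrA -(rmorphM (real_complex R)).
Qed.
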